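(* Let $X$ be a Banach space over $\mathbb{K}$ ($\mathbb{K}=\mathbb{R}$ or $\mathbb{C}$) and let $T : X \to X$ be an invertible generalized hyperbolic operator. Then the following properties hold. (A) There exists $\varepsilon > 0$ such that for any $p \in \mathbb{N}$ and any bounded Lipschitz maps $L_j : X \to X$, $j = 1,\ldots,p$, with $\operatorname{Lip}(L_j) < \varepsilon$ for all $j \in \{1,\ldots,p\}$, there exists a homeomorphism $h : X \to X$ satisfying $$(T+L_1) \circ \cdots \circ (T+L_p) = h \circ T^p \circ h^{-1} \quad\text{and}\quad \|h - I_X\|_\infty < \infty.$$ (B) Given $\delta > 0$, there exists $\varepsilon > 0$ such that for any $p \in \mathbb{N}$ and any Lipschitz maps $L_j : X \to X$, $j = 1,\ldots,p$, with $\|L_j\|_\infty < \varepsilon$ and $\operatorname{Lip}(L_j) < \varepsilon$ for all $j \in \{1,\ldots,p\}$, there exists a homeomorphism $h : X \to X$ satisfying $$(T+L_1) \circ \cdots \circ (T+L_p) = h \circ T^p \circ h^{-1} \quad\text{and}\quad \|h - I_X\|_\infty < \delta.$$ Moreover, the number $\varepsilon$ in (A) (resp., for each $\delta>0$, the number $\varepsilon$ in (B)) can be taken so that the following also hold. (Uniqueness) For each $p \in \mathbb{N}$ and each $p$-tuple $(L_1,\ldots,L_p)$ of maps as in (A) (resp. (B)), the homeomorphism $h$ satisfying the two displayed conditions of (A) (resp. (B)) is unique if and only if the operator $T$ is hyperbolic. (Continuous dependence) Whether or not $T$ is hyperbolic, for each $p\in\mathbb{N}$ it is possible to choose, for each $p$-tuple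 $\mathcal{L} = (L_1,\ldots,L_p)$ of maps as in (A) (resp. (B)), a homeomorphism $h_{\mathcal{L}}$ satisfying the two displayed conditions of (A) (resp. (B)) in such a way that the correspondence $\mathcal{L} \mapsto h_{\mathcal{L}}$ is uniformly continuous in the following sense: given $\gamma > 0$, there exists $\eta > 0$ such that $$\|h_{\mathcal{L}} - h_{\mathcal{L}'}\|_\infty < \gamma$$ whenever $\mathcal{L} = (L_1,\ldots,L_p)$ and $\mathcal{L}' = (L'_1,\ldots,L'_p)$ are $p$-tuples of maps as in (A) (resp. (B)) with $\|L_j - L'_j\|_\infty < \eta$ for all $j \in \{1,\ldots,p\}$.
   Context: $\mathbb{N}$ denotes the set of positive integers. An operator on a Banach space $X$ is a continuous linear map $X \to X$; $T$ invertible means it is bijective with continuous inverse. $I_X$ is the identity operator on $X$. $\sigma(\cdot)$ denotes the spectrum (for real Banach spaces, understood as the spectrum of the complexification), and $\mathbb{D}$ is the open unit disc in $\mathbb{C}$. For a map $F : X \to X$ (not necessarily linear), $\|F\|_\infty = \sup_{x \in X}\|F(x)\|$ and $\operatorname{Lip}(F) = \sup_{x \neq x'} \frac{\|F(x)-F(x')\|}{\|x-x'\|}$; $F$ is bounded if $\|F\|_\infty < \infty$ and Lipschitz if $\operatorname{Lip}(F) < \infty$. An invertible operator $T$ on $X$ is hyperbolic if $\sigma(T)$ does not intersect the unit circle in the complex plane. An invertible operator $T$ on $X$ is generalized hyperbolic if there is a direct sum decomposition $X = M \oplus N$, where $M$ and $N$ are closed subspaces of $X$ such that (GH1) $T(M)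 \subset M$ and $\sigma(T|_M) \subset \mathbb{D}$, (GH2) $T^{-1}(N) \subset N$ and $\sigma(T^{-1}|_N) \subset \mathbb{D}$. ''Maps as in (A)'' means: bounded Lipschitz maps $L_j : X \to X$ with $\operatorname{Lip}(L_j) < \varepsilon$ for all $j$, with $\varepsilon$ the number from (A). ''Maps as in (B)'' means: Lipschitz maps $L_j : X \to X$ with $\|L_j\|_\infty < \varepsilon$ and $\operatorname{Lip}(L_j) < \varepsilon$ for all $j$, with $\varepsilon$ the number from (B) for the given $\delta$. *)

(* Defs.v *)
From HB Require Import structures.
From mathcomp Require Import all_boot all_order all_algebra.
From mathcomp Require Import complex.
From mathcomp Require Import all_classical all_reals all_analysis.

Set Implicit Arguments.
Unset Strict Implicit.
Unset Printing Implicit Defensive.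

Import Order.TTheory GRing.Theory Num.Theory.
Import numFieldNormedType.Exports.

Local Open Scope classical_set_scope.
Local Open Scope ring_scope.

Inductive base_field := RealScalars | ComplexScalars.

Definition scalars (R : realType) (k : base_field) : numFieldType :=
  match k with RealScalars => R : numFieldType
             | ComplexScalars => R[i] : numFieldType end.

(* The library norm of a normed module over R[i] takes values in R[i] (with
   zero imaginary part); [nrm] is the norm as an element of R in both cases. *)
Definition nrm (R : realType) (k : base_field) :
    forall X : normedModType (scalars R k), X -> R :=
  match k with
  | RealScalars => fun X x => `|x|
  | ComplexScalars => fun X x => complex.Re `|x|
  end.

Section Seminorms.
Context {R : realType} {k : base_field} {X : normedModType (scalars R k)}.
Local Open Scope ereal_scope.

Definition sup_norm (F : X -> X) : \bar R :=
  ereal_sup [set (nrm (F x))%:E | x in [set: X]].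

(* On the zero space the supremum is over the empty set, hence is -oo; there
   [Lip F < e] still holds for every positive e. *)
Definition Lip (F : X -> X) : \bar R :=
  ereal_sup [set (nrm (F u.1 - F u.2)%R / nrm (u.1 - u.2)%R)%:E |
               u in [set u : X * X | u.1 <> u.2]].

End Seminorms.

Definition inverse_on (X : topologicalType) (M : set X) (A S : X -> X) : Prop :=
  [/\ set_fun M M A, set_fun M M S, {in M, cancel A S}, {in M, cancel S A}
    & {within M, continuous S}].

Definition inverse_operator (X : topologicalType) (T S : X -> X) : Prop :=
  inverse_on [set: X] T S.

Definition invertible_operator (X : topologicalType) (T : X -> X) : Prop :=
  continuous T /\ exists S, inverse_operator T S.

(* The spectrum of the operator A|_M : M -> M, for a subspace M invariant
   under A. *)
Definition complex_spectrum (R : realType) (V : preTopologicalLmodType R[i])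
    (M : set V) (A : V -> V) : set R[i] :=
  [set l | ~ exists S, inverse_on M (fun x => A x - l *: x) S].

(* The pair (x, y) stands for x + i y.  The product topology is the one given
   by any of the usual norms of the complexification. *)
Definition complexification (R : realType) (X : normedModType R) : Type :=
  (X * X)%type.

Section Complexification.
Context {R : realType} {X : normedModType R}.
Local Notation XC := (complexification X).

HB.instance Definition _ := Topological.copy XC (X * X)%type.
HB.instance Definition _ := GRing.Zmodule.copy XC (X * X)%type.

Definition complexification_scale (l : R[i]) (z : XC) : XC :=
  (complex.Re l *: z.1 - complex.Im l *: z.2,
   complex.Re l *: z.2 + complex.Im l *: z.1).

Fact complexification_scaleA a b z :
  complexification_scale a (complexification_scale b z) =
  complexification_scale (a * b) z.
Proof.
case: a b z => [a1 a2] [b1 b2] [x y]; rewrite /complexification_scale /=.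
rewrite !(scalerBr, scalerDr, scalerBl, scalerDl, scalerA).
congr pair; rewrite ?opprD -!addrA; congr (_ + _).
- by rewrite [RHS]addrC -addrA.
- by rewrite [RHS]addrC -addrA.
Qed.

Fact complexification_scale1 : left_id 1 complexification_scale.
Proof.
case=> x y; rewrite /complexification_scale /=.
by rewrite !scale1r !scale0r subr0 addr0.
Qed.

Fact complexification_scaleDr : right_distributive complexification_scale +%R.
Proof.
move=> a [x y] [z t]; rewrite /complexification_scale /=.
by congr pair; rewrite !scalerDr ?opprD addrACA.
Qed.

Fact complexification_scaleDl z :
  {morph complexification_scale^~ z : a b / a + b}.
Proof.
case: z => x y [a1 a2] [b1 b2]; rewrite /complexification_scale /=.
by congr pair; rewrite !scalerDl ?opprD addrACA.
Qed.

HB.instance Definition _ := GRing.Zmodule_isLmodule.Build R[i] XC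
  complexification_scaleA complexification_scale1
  complexification_scaleDr complexification_scaleDl.

Definition complexify (A : X -> X) (z : XC) : XC := (A z.1, A z.2).

End Complexification.

Definition spectrum_on (R : realType) (k : base_field) :
    forall X : normedModType (scalars R k), set X -> (X -> X) -> set R[i] :=
  match k with
  | RealScalars => fun X M A =>
      @complex_spectrum R (complexification X) (M `*` M) (complexify A)
  | ComplexScalars => fun X M A => @complex_spectrum R X M A
  end.

Section Hyperbolicity.
Context {R : realType} {k : base_field} {X : normedModType (scalars R k)}.

Definition hyperbolic (T : X -> X) : Prop :=
  invertible_operator T /\
  spectrum_on [set: X] T `&` [set l | `|l| = 1] = set0.

Definition closed_subspace (M : set X) : Prop :=
  submod_closed (mem M) /\ closed M.

Definition direct_sum (M N : set X) : Prop :=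
  M `&` N = [set 0] /\ forall x, exists m n, [/\ M m, N n & x = m + n].

Definition generalized_hyperbolic (T : X -> X) : Prop :=
  continuous T /\
  exists S, inverse_operator T S /\
  exists M N,
    [/\ closed_subspace M, closed_subspace N & direct_sum M N] /\
    (T @` M `<=` M /\ spectrum_on M T `<=` [set l | `|l| < 1]) /\
    (S @` N `<=` N /\ spectrum_on N S `<=` [set l | `|l| < 1]).

Definition homeomorphism_with_inverse (h g : X -> X) : Prop :=
  [/\ cancel h g, cancel g h, continuous h & continuous g].

(* Index 0 of the tuple is the leftmost, i.e. outermost, factor. *)
Definition perturbed_product (T : X -> X) (p : nat) (L : 'I_p -> X -> X) :
    X -> X :=
  \big[comp/idfun]_(j < p) (T \+ L j).

Definition conjugates (h F G : X -> X) : Prop :=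
  exists g, homeomorphism_with_inverse h g /\ F = h \o G \o g.

End Hyperbolicity.

(* Main.v *)
Require Import Defs.
From HB Require Import structures.
From mathcomp Require Import all_boot all_order all_algebra.
From mathcomp Require Import complex ring lra.
From mathcomp Require Import all_classical all_reals all_analysis.

(* Let P, Q be the projections onto M and N, bounded by Baire's theorem, and let
   S = T^-1.  The spectral hypotheses make some power of T on M and of S on N a
   contraction; in a suitable equivalent norm T P + S Q becomes one.

   Put A_j = T + L_j and B_j = T + L'_j.  A family k_j = I + u_j with
   A_j k_(j+1) = k_j B_j, indices modulo p, is a solution of
   u_j B_j - T u_(j+1) = L_j k_(j+1) - L'_j.  Solving the M-component of this
   equation for u_j and the N-component for u_(j+1) turns it into a fixed point
   problem for a contraction whose constants do not depend on p.  Its bounded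
   solution u(L, L') is unique, and the fixed point equation is preserved by
   composition of the k_j: k(L, L') k(L', L'') = k(L, L'').  Hence k(L, 0) is a
   homeomorphism, with inverse k(0, L).

   If T N is contained in N, every solution of the equation solves the fixed
   point problem, whence uniqueness, and T is hyperbolic.  Otherwise there is
   x <> 0 in N with T x in M; inverting I - S on N and I - T on M, one sums the
   homoclinic orbit of x to a nonzero fixed vector v of T.  Then 1 lies in the
   spectrum of T, and h may be replaced by y |-> h (y + v). *)

Set Implicit Arguments.
Unset Strict Implicit.
Unset Printing Implicit Defensive.

Import Order.TTheory GRing.Theory Num.Theory.
Import numFieldNormedType.Exports.

Local Open Scope classical_set_scope.
Local Open Scope ring_scope.

(** * Restriction of scalars *)

(* The uniform structure is that of X, so continuity over R and over R[i] are
   convertible statements. *)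

(** The difference between the product of the T + L_j and T^p has no Lipschitz bound uniform in p,
    so perturbing T^p directly would make epsilon depend on p; the cyclic system compares T with one
    T + L_j at a time. As T N need not lie in N, the conjugacy equation may have many bounded
    solutions. The fixed point problem singles out one by an additional linear condition: T maps the
    N-part of u_j back into N. This condition survives sums and substitution of one conjugacy into
    another, hence composition, which is why uniqueness can produce inverses even when T is not
    hyperbolic. The spectral hypotheses are used without contour integrals or power series: finite
    averages of resolvents over roots of unity take their place. That argument is carried out on a
    complex space V with a function [nu] that is homogeneous for real scalars, so that it applies to
    the complexification as well; the nonlinear part is done over the reals, a complex space being
    regarded as a real one. *)

Definition realification (R : realType) (X : completeNormedModType R[i]) : Type := X.

Section Realification.
Context {R : realType} {X : completeNormedModType R[i]}.
Local Notation Y := (realification X).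

HB.instance Definition _ := GRing.Zmodule.copy Y X.
HB.instance Definition _ := Complete.copy Y X.

Definition realification_scale (t : R) (x : Y) : Y := (t%:C%C *: (x : X) : X).

Fact realification_scaleA a b x :
  realification_scale a (realification_scale b x) = realification_scale (a * b) x.
Proof. by rewrite /realification_scale scalerA rmorphM. Qed.

Fact realification_scale1 : left_id 1 realification_scale.
Proof. by move=> x; rewrite /realification_scale scale1r. Qed.

Fact realification_scaleDr : right_distributive realification_scale +%R.
Proof. by move=> a x y; rewrite /realification_scale scalerDr. Qed.

Fact realification_scaleDl x : {morph realification_scale^~ x : a b / a + b}.
Proof. by move=> a b; rewrite /realification_scale rmorphD /= scalerDl. Qed.

HB.instance Definition _ := GRing.Zmodule_isLmodule.Build R Y
  realification_scaleA realification_scale1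
  realification_scaleDr realification_scaleDl.

Definition realification_norm (x : Y) : R := complex.Re `|x : X|.

Lemma realification_normE (x : Y) : `|x : X| = (realification_norm x)%:C%C.
Proof. by rewrite /realification_norm RRe_real// normr_real. Qed.

Fact realification_normD x y :
  realification_norm (x + y) <= realification_norm x + realification_norm y.
Proof. by rewrite -lecR rmorphD /= -!realification_normE ler_normD. Qed.

Fact realification_norm0 x : realification_norm x = 0 -> x = 0.
Proof.
by move=> x0; apply/eqP; rewrite -[x == 0](@normr_eq0 _ X) realification_normE x0.
Qed.

Fact realification_normMn x n :
  realification_norm (x *+ n) = realification_norm x *+ n.
Proof.
apply: (@complexI R); rewrite rmorphMn /= -!realification_normE.
exact: (@normrMn _ X).
Qed.

Fact realification_normN x : realification_norm (- x) = realification_norm x.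
Proof. by rewrite /realification_norm (@normrN _ X). Qed.

HB.instance Definition _ := Num.Zmodule_isNormed.Build R Y
  realification_normD realification_norm0 realification_normMn realification_normN.

Definition realification_ball (x : Y) (e : R) : set Y := ball_ Num.norm x e.

Lemma realification_ballE x e :
  realification_ball x e = ball (x : X) e%:C%C :> set X.
Proof.
rewrite -ball_normE; apply/seteqP; split=> y; rewrite /realification_ball /=;
  by rewrite -ltcR realification_normE.
Qed.

Fact realification_ball_center x (e : R) : 0 < e -> realification_ball x e x.
Proof. by move=> e0; rewrite /realification_ball /= subrr normr0. Qed.

Fact realification_ball_sym x y (e : R) :
  realification_ball x e y -> realification_ball y e x.
Proof. by rewrite /realification_ball /= distrC. Qed.

Fact realification_ball_triangle x y z (e1 e2 : R) :
  realification_ball x e1 y -> realification_ball y e2 z ->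
  realification_ball x (e1 + e2) z.
Proof.
rewrite /realification_ball /= => xy yz.
by rewrite (le_lt_trans (ler_distD y _ _))// ltrD.
Qed.

(** An element of R[i] that is positive in the complex order has zero imaginary part, so real and
    complex radii give the same balls. *)
Fact realification_entourageE :
  entourage = entourage_ realification_ball :> set_system (Y * Y).
Proof.
rewrite -[LHS]/(@entourage X) -entourage_ballE; apply/seteqP; split=> E.
  move=> [e /= e0 eE]; have er : e = (complex.Re e)%:C%C.
    by rewrite RRe_real// gtr0_real.
  exists (complex.Re e) => /=; first by rewrite -ltcR -er.
  by move=> [x y] /= xy; apply: eE => /=; rewrite er -realification_ballE.
move=> [e /= e0 eE]; exists e%:C%C => /=; first by rewrite ltcR.
by move=> [x y] /= xy; apply: eE => /=; rewrite realification_ballE.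
Qed.

HB.instance Definition _ := Uniform_isPseudoMetric.Build R Y
  realification_ball_center realification_ball_sym realification_ball_triangle
  realification_entourageE.

HB.instance Definition _ := NormedZmod_PseudoMetric_eq.Build R Y erefl.

Fact realification_normZ (l : R) (x : Y) : `|l *: x| = `|l| * `|x|.
Proof.
apply: (@complexI R); rewrite rmorphM /= -!realification_normE (@normrZ _ X).
by congr (_ * _); rewrite normc_def /= expr0n addr0 sqrtr_sqr.
Qed.

HB.instance Definition _ :=
  PseudoMetricNormedZmod_Lmodule_isNormedModule.Build R Y realification_normZ.

End Realification.

(** * Power contraction from the spectrum *)

Definition taxicab (R : realType) (l : R[i]) : R :=
  `|complex.Re l| + `|complex.Im l|.

(* On the complexification |x| + |y| is homogeneous for real scalars only; the
   bound by the taxicab norm of the scalar is what remains for complex ones. *)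
Record compatible_norm (R : realType) (V : preTopologicalLmodType R[i])
    (nu : V -> R) : Prop := CompatibleNorm {
  nuD : forall x y, nu (x + y) <= nu x + nu y ;
  nu_eq0 : forall x, nu x = 0 -> x = 0 ;
  nuZ : forall (t : R) x, nu (t%:C%C *: x) = `|t| * nu x ;
  nu_taxicab : forall l x, nu (l *: x) <= taxicab l * nu x ;
  nbhs_nu : forall x (U : set V),
    nbhs x U <-> exists2 e, 0 < e & forall y, nu (y - x) < e -> U y }.

Section CompatibleNorm.
Context {R : realType} {V : preTopologicalLmodType R[i]} {nu : V -> R}.
Hypothesis nuP : compatible_norm nu.

Lemma nu0 : nu 0 = 0.
Proof. by have := nuZ nuP 0 0; rewrite scaler0 normr0 mul0r. Qed.

Lemma nuN x : nu (- x) = nu x.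
Proof. by have := nuZ nuP (-1) x; rewrite rmorphN1 scaleN1r normrN normr1 mul1r. Qed.

Lemma nuB x y : nu (x - y) <= nu x + nu y.
Proof. by rewrite -(nuN y) (nuD nuP). Qed.

Lemma nu_ge0 x : 0 <= nu x.
Proof. by have := nuB x x; rewrite subrr nu0 -mulr2n pmulrn_lge0. Qed.

Lemma nu_sub x y : nu x - nu y <= nu (x - y).
Proof. by rewrite lerBlDr -{1}(subrK y x) (nuD nuP). Qed.

End CompatibleNorm.

Lemma norm_complex_ge1 (R : rcfType) (l : R[i]) :
  (1 <= `|l|) = (1 <= complex.Re l ^+ 2 + complex.Im l ^+ 2).
Proof.
rewrite normc_def lecR -{1}sqrtr1 ler_sqrt//.
by rewrite addr_ge0 ?sqr_ge0.
Qed.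

Lemma norm_complex_parts (R : rcfType) (l : R[i]) :
  `|l| = 1 -> `|complex.Re l| <= 1 /\ `|complex.Im l| <= 1.
Proof.
case: l => a b; rewrite normc_def /= => /(@complexI R) ab1.
have := @sqr_sqrtr R (a ^+ 2 + b ^+ 2); rewrite ab1 expr1n addr_ge0 ?sqr_ge0//.
move=> /(_ isT) ab.
by rewrite !ler_norml; split; apply/andP; split; nra.
Qed.

Section SpectralRadius.
Context {R : realType} {V : preTopologicalLmodType R[i]} {nu : V -> R}.
Hypothesis nuP : compatible_norm nu.
Context {M : set V} {A : {linear V -> V}} {K : R}.
Hypotheses (M0 : M 0) (MD : forall x y, M x -> M y -> M (x + y)).
Hypotheses (MZ : forall l x, M x -> M (l *: x)) (MA : forall x, M x -> M (A x)).
Hypotheses (AK : forall x, nu (A x) <= K * nu x).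

(** Continuity of the inverse at 0 bounds it on a small ball, and real homogeneity carries the bound
    to every vector of M. *)
Lemma inverse_on_bounded_below (l : R[i]) :
  (exists S, inverse_on M (fun x => A x - l *: x) S) ->
  exists2 d, 0 < d & forall x, M x -> d * nu x <= nu (A x - l *: x).
Proof.
move=> [S [_ _ AS SA /subspace_continuousP/(_ 0 M0) cS]].
have S0 : S 0 = 0 by have := AS 0; rewrite raddf0 scaler0 subr0 inE; apply.
have /cS : nbhs (S 0) [set y | nu y < 1].
  by apply/(nbhs_nu nuP); exists 1 => // y; rewrite S0 subr0.
rewrite /within /= => /(nbhs_nu nuP)[d d0 dS]; exists d => // x Mx.
have {}dS z : nu z < d -> M z -> nu (S z) < 1 by move=> zd; apply: dS; rewrite subr0.
rewrite leNgt; apply/negP => xd.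
have x0 : 0 < nu x.
  rewrite lt_neqAle nu_ge0// andbT eq_sym; apply/eqP => x0.
  by move: xd; rewrite x0 mulr0 ltNge nu_ge0.
pose t : R := (nu x)^-1; pose y := t%:C%C *: x.
have t0 : 0 < t by rewrite invr_gt0.
have My : M y by apply: MZ.
have yE : A y - l *: y = t%:C%C *: (A x - l *: x).
  by rewrite linearZ_LR scalerBr !scalerA mulrC.
have ASy : S (A y - l *: y) = y by apply: AS; rewrite inE.
have := dS (A y - l *: y); rewrite ASy (nuZ nuP) yE (nuZ nuP).
rewrite gtr0_norm// mulVf ?gt_eqF// ltxx => H; apply/notF/H.
  by rewrite mulrC ltr_pdivrMr.
by rewrite -yE; apply: MD; [exact: MA|rewrite -scaleN1r; do 2!apply: MZ].
Qed.

(** The pointwise lower bound persists near each scalar, and the box is compact; working with a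
    constant c near 0 from the right replaces the choice of a minimum over a finite cover. *)
Lemma uniformly_bounded_below (B : R) :
  (forall l, 1 <= `|l| -> exists S, inverse_on M (fun x => A x - l *: x) S) ->
  exists2 c, 0 < c & forall l, 1 <= `|l| ->
    `|complex.Re l| <= B -> `|complex.Im l| <= B ->
    forall x, M x -> c * nu x <= nu (A x - l *: x).
Proof.
move=> inv.
pose P (c : R) (z : R * R) := 0 < c /\ (1 <= `|(z.1 +i* z.2)%C| ->
  forall x, M x -> c * nu x <= nu (A x - (z.1 +i* z.2)%C *: x)).
have boxC : compact (`[-B, B] `*` `[-B, B] : set (R * R)).
  by apply: compact_setX; exact: segment_compact.
have : \forall c \near (0:R)^'+, `[-B, B] `*` `[-B, B] `<=` P c.
  move/compact_near_coveringP : boxC; apply => -[a b] _.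
  (* Strictly inside the unit disc the claim is vacuous on a whole neighbourhood, so every c > 0
     will do. *)
  have [ab1|ab1] := leP 1 (a ^+ 2 + b ^+ 2); last first.
    have cont : {for (a, b), continuous (fun z : R * R => z.1 ^+ 2 + z.2 ^+ 2)}.
      by apply: cvgD; apply: (@cvgM R); (exact: cvg_fst || exact: cvg_snd).
    have nz : \forall z \near (a, b), z.1 ^+ 2 + z.2 ^+ 2 < 1.
      exact: (cvgr_lt _ cont).
    near=> z c => /=; split=> // z1; exfalso.
    have : z.1 ^+ 2 + z.2 ^+ 2 < 1 by near: z.
    by rewrite ltNge => /negP; apply; rewrite norm_complex_ge1 in z1.
  (* A shift of the scalar by at most d / 2 in the taxicab norm costs at most half of the lower
     bound d; c stays below the other half. *)
  have /inv/inverse_on_bounded_below[d d0 dA] : 1 <= `|(a +i* b)%C|.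
    by rewrite norm_complex_ge1.
  near=> z c => /=; split=> // z1 x Mx.
  have cd : c <= d / 2 by near: c; apply: nbhs_right_le; rewrite divr_gt0.
  have zd : `|a - z.1| + `|b - z.2| <= d / 2.
    near: z; have d4 : 0 < d / 4 by rewrite divr_gt0.
    exists (ball a (d / 4), ball b (d / 4)); first by split; exact: nbhsx_ballx.
    by move=> [u v] [/= au bv]; rewrite -!ball_normE /= in au bv; lra.
  have -> : A x - (z.1 +i* z.2)%C *: x =
      A x - (a +i* b)%C *: x + ((a - z.1) +i* (b - z.2))%C *: x.
    rewrite -addrA -!scaleNr -scalerDl; congr (_ + _ *: _).
    by apply/eqP; rewrite eq_complex /=; apply/andP; split; apply/eqP; ring.
  rewrite -[X in _ + X]opprK; apply: le_trans (nu_sub nuP _ _).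
  rewrite (nuN nuP) lerBrDr.
  have := dA x Mx; have := nu_taxicab nuP ((a - z.1) +i* (b - z.2))%C x.
  rewrite {1}/taxicab /=; have := nu_ge0 nuP x; move: zd cd.
  move: (nu _) (nu (A x - _)) (nu (_ *: x)) => n0 n1 n2; nra.
move=> H; have [c [c0 cP]] : exists c, 0 < c /\ `[-B, B] `*` `[-B, B] `<=` P c.
  near (0:R)^'+ => c; exists c; split=> //.
  by near: c.
exists c => // l l1 lr li x Mx.
have /cP[_] : (`[-B, B] `*` `[-B, B]) (complex.Re l, complex.Im l).
  by split; rewrite /= in_itv /= -ler_norml.
by case: l l1 {lr li} => a b /= l1; apply.
Unshelve. all: by end_near. Qed.

Hypothesis inv : forall l : R[i],
  1 <= `|l| -> exists S, inverse_on M (fun x => A x - l *: x) S.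
Hypothesis K0 : 0 <= K.

Definition scaled_iter (l : R[i]) n (x : V) : V := l ^- n *: iter n A x.

Lemma scaled_iterD l m n x :
  scaled_iter l (m + n) x = scaled_iter l m (scaled_iter l n x).
Proof.
rewrite /scaled_iter iterD exprD invfM -scalerA; congr (_ *: _).
by elim: m => //= m <-; rewrite linearZ_LR.
Qed.

Lemma scaled_iter_add l n : {morph scaled_iter l n : x y / x + y}.
Proof.
move=> x y; rewrite /scaled_iter -scalerDr; congr (_ *: _).
by elim: n => //= n ->; rewrite raddfD.
Qed.

Lemma scaled_iterZ l n a x : scaled_iter l n (a *: x) = a *: scaled_iter l n x.
Proof.
rewrite /scaled_iter [RHS]scalerA mulrC -scalerA; congr (_ *: _).
by elim: n => //= n ->; rewrite linearZ_LR.
Qed.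

Lemma scaled_iterN l n x : scaled_iter l n (- x) = - scaled_iter l n x.
Proof. by rewrite -scaleN1r scaled_iterZ scaleN1r. Qed.

Lemma scaled_iter_in l n x : M x -> M (scaled_iter l n x).
Proof. by move=> Mx; apply: MZ; elim: n => //= n /MA. Qed.

(** A primitive 2^(m+1)-th root of unity w. Replacing l by w l keeps the modulus and changes the
    sign of B = (A / l)^(2^m), so that I + B is again of the form I - B. *)
Fixpoint root_of_minus1 m : R[i] :=
  if m is k.+1 then sqrtC (root_of_minus1 k) else -1.

Lemma root_of_minus1X m : root_of_minus1 m ^+ (2 ^ m) = -1.
Proof. by elim: m => [|m IH] //=; rewrite expnS exprM sqrtCK. Qed.

Lemma norm_root_of_minus1 m : `|root_of_minus1 m| = 1.
Proof.
elim: m => [|m IH] /=; first by rewrite normrN1.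
by apply/eqP; rewrite -sqrp_eq1// -normrX sqrtCK IH.
Qed.

Lemma scaled_iter_root l m x :
  scaled_iter (root_of_minus1 m * l) (2 ^ m) x = - scaled_iter l (2 ^ m) x.
Proof.
by rewrite /scaled_iter exprMn root_of_minus1X mulN1r invrN scaleNr.
Qed.

Lemma resolvent_ex : exists r : R[i] -> V -> V, forall l x, 1 <= `|l| -> M x ->
  M (r l x) /\ l *: r l x - A (r l x) = x.
Proof.
have /choice[f fP] : forall l, exists S, 1 <= `|l| ->
    inverse_on M (fun x => A x - l *: x) S.
  move=> l; have [/inv[S SP]|nl] := pselect (1 <= `|l|); first by exists S.
  by exists idfun => /nl.
exists (fun l x => - f l x) => l x /fP[_ fM _ fK _] Mx.
split; first by rewrite -scaleN1r; apply/MZ/fM.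
by rewrite /= !raddfN opprK addrC; apply: fK; rewrite inE.
Qed.

(** With B = (A / l)^(2^m) one has I - B^2 = (I - B) (I + B), and I + B is I - B at the scalar w l;
    the induction ends at the injectivity of A - l. *)
Lemma scaled_iter_injective m l x : 1 <= `|l| -> M x ->
  scaled_iter l (2 ^ m) x = x -> x = 0.
Proof.
elim: m l x => [|m IH] l x l1 Mx.
  rewrite /scaled_iter expn0 expr1 /= => lx.
  have l0 : l != 0 by rewrite -normr_gt0 (lt_le_trans ltr01).
  have [d d0 /(_ x Mx)] := inverse_on_bounded_below (inv l1).
  rewrite -{3}lx scalerA mulfV// scale1r subrr nu0// pmulr_rle0// => x0.
  by apply: (nu_eq0 nuP); apply/eqP; rewrite eq_le x0 nu_ge0.
rewrite expnS mul2n -addnn scaled_iterD => xE.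
have : x + scaled_iter l (2 ^ m) x = 0.
  apply: (IH l) => //; first by apply/MD/scaled_iter_in.
  by rewrite scaled_iter_add xE addrC.
move/eqP; rewrite addr_eq0 => /eqP xN.
apply: (IH (root_of_minus1 m * l)) => //.
  by rewrite normrM norm_root_of_minus1 mul1r.
by rewrite scaled_iter_root -xN.
Qed.

Section Resolvent.
Variable r : R[i] -> V -> V.
Hypothesis rP : forall l x, 1 <= `|l| -> M x ->
  M (r l x) /\ l *: r l x - A (r l x) = x.

(* The inverse of I - (A / l)^(2^m) is the mean of (I - A / (w l))^-1 over the
   2^m-th roots of unity w.  Hence it is Lipschitz in |l|, uniformly in m, and
   smallness of (A / l)^(2^m) propagates from large |l| down to |l| = 1 in
   finitely many steps. *)
Fixpoint mean_resolvent m (l : R[i]) (x : V) : V :=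
  if m is k.+1 then
    2^-1 *: (mean_resolvent k l x + mean_resolvent k (root_of_minus1 k * l) x)
  else l *: r l x.

(** The induction step is the partial fraction identity 2 (I - B^2)^-1 = (I - B)^-1 + (I + B)^-1 for
    B = (A / l)^(2^m). *)
Lemma mean_resolventP m l x : 1 <= `|l| -> M x ->
  M (mean_resolvent m l x) /\
  mean_resolvent m l x - scaled_iter l (2 ^ m) (mean_resolvent m l x) = x.
Proof.
elim: m l => [|m IH] l l1 Mx /=.
  have l0 : l != 0 by rewrite -normr_gt0 (lt_le_trans ltr01).
  have [Mr rE] := rP l1 Mx; split; first exact: MZ.
  by rewrite scaled_iterZ /scaled_iter expn0 expr1 /= scalerA mulfV// scale1r.
have [M1] := IH l l1 Mx; set q1 := mean_resolvent m l x in M1 * => q1E.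
have zl1 : 1 <= `|root_of_minus1 m * l|.
  by rewrite normrM norm_root_of_minus1 mul1r.
have [M2] := IH _ zl1 Mx; set q2 := mean_resolvent m _ x in M2 *.
rewrite scaled_iter_root opprK => q2E.
split; first by apply: MZ; exact: MD.
rewrite expnS mul2n -addnn scaled_iterD; set B := scaled_iter l (2 ^ m) in q1E q2E *.
have BZ a v : B (a *: v) = a *: B v by exact: scaled_iterZ.
have BD : {morph B : v w / v + w} by exact: scaled_iter_add.
have BN v : B (- v) = - B v by exact: scaled_iterN.
clearbody B.
have q1B : B (B q1) = B q1 - B x.
  by rewrite -{1}q1E BD BN opprB addrCA subrr addr0.
have q2B : B (B q2) = B x - B q2 by rewrite -{1}q2E BD addrAC subrr add0r.
rewrite !BZ -scalerBr !BD q1B q2B.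
have -> : q1 + q2 - (B q1 - B x + (B x - B q2)) = (q1 - B q1) + (q2 + B q2).
  by rewrite addrA subrK opprB [B q2 - B q1]addrC addrACA.
by rewrite q1E q2E -mulr2n -[x *+ 2]scaler_nat scalerA mulVf ?scale1r// pnatr_eq0.
Qed.

Context {c B : R}.
Hypotheses (c0 : 0 < c) (cP : forall l, 1 <= `|l| ->
    `|complex.Re l| <= B -> `|complex.Im l| <= B ->
    forall x, M x -> c * nu x <= nu (A x - l *: x)).

(** Averaging preserves a Lipschitz constant, so only m = 0 needs an estimate. There the resolvent
    identity writes the difference as A applied to a product of two resolvents, each bounded by 1 /
    c; the factor 2 bounds the taxicab norm of a unit scalar. *)
Lemma mean_resolvent_lipschitz m (z : R[i]) (s t : R) x : `|z| = 1 ->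
  1 <= s <= B -> 1 <= t <= B -> M x ->
  nu (mean_resolvent m (s%:C%C * z) x - mean_resolvent m (t%:C%C * z) x) <=
  2 * K / c ^+ 2 * `|s - t| * nu x.
Proof.
move=> + sB tB Mx; elim: m z => [|m IH] z z1 /=; last first.
  rewrite -scalerBr opprD addrACA.
  have -> : 2^-1 = (2^-1)%:C%C :> R[i] by rewrite fmorphV rmorph_nat.
  rewrite (nuZ nuP) ger0_norm ?invr_ge0//.
  have := IH z z1; have := IH (root_of_minus1 m * z).
  rewrite normrM norm_root_of_minus1 mul1r => /(_ z1).
  rewrite ![root_of_minus1 m * (_ * z)]mulrCA.
  have := nuD nuP (mean_resolvent m (s%:C%C * z) x - mean_resolvent m (t%:C%C * z) x)
    (mean_resolvent m (s%:C%C * (root_of_minus1 m * z)) x -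
     mean_resolvent m (t%:C%C * (root_of_minus1 m * z)) x).
  lra.
have unit a : 1 <= a <= B -> [/\ 1 <= `|a%:C%C * z|,
    `|complex.Re (a%:C%C * z)| <= B & `|complex.Im (a%:C%C * z)| <= B].
  move=> /andP[a1 aB]; have a0 : 0 <= a by rewrite (le_trans ler01).
  have [zr zi] := norm_complex_parts z1.
  split.
  - rewrite normrM z1 mulr1 normc_def /= expr0n addr0 sqrtr_sqr ger0_norm//.
    by rewrite -(rmorph1 (real_complex R)) lecR.
  - by case: (z) zr zi => u v /= zr zi; rewrite mul0r subr0 normrM ger0_norm//; nra.
  - by case: (z) zr zi => u v /= zr zi; rewrite mul0r addr0 normrM ger0_norm//; nra.
have [s1 sr si] := unit s sB; have [t1 tr ti] := unit t tB.
have [Ms sE] := rP s1 Mx; have [Mt tE] := rP t1 Mx.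
set ls := s%:C%C * z in s1 sr si Ms sE *; set lt := t%:C%C * z in t1 tr ti Mt tE *.
have AsE : A (r ls x) = ls *: r ls x - x by rewrite -[X in _ - X]sE opprB addrC subrK.
have AtE : A (r lt x) = lt *: r lt x - x by rewrite -[X in _ - X]tE opprB addrC subrK.
have -> : ls *: r ls x - lt *: r lt x = A (r ls x - r lt x).
  by rewrite linearB AsE AtE opprB subrKA.
have Mst : M (r ls x - r lt x) by apply: MD; rewrite // -scaleN1r; exact: MZ.
have dE : A (r ls x - r lt x) - ls *: (r ls x - r lt x) = (ls - lt) *: r lt x.
  rewrite linearB scalerBr scalerBl AsE AtE opprB subrKA opprB.
  by rewrite addrC subrKA.
have tx : c * nu (r lt x) <= nu x.
  by rewrite (le_trans (cP t1 tr ti Mt))// -(nuN nuP) opprB tE.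
have dst : c * nu (r ls x - r lt x) <= 2 * `|s - t| * nu (r lt x).
  rewrite (le_trans (cP s1 sr si Mst))// dE (le_trans (nu_taxicab nuP _ _))//.
  rewrite ler_wpM2r ?nu_ge0// -mulrBl -rmorphB.
  have [zr zi] := norm_complex_parts z1.
  case: (z) zr zi => u v /= zr zi; rewrite /taxicab /= !mul0r addr0 subr0 !normrM.
  by have := normr_ge0 (s - t); nra.
apply: le_trans (AK _) _.
have -> : 2 * K / c ^+ 2 * `|s - t| * nu x = K * (2 * `|s - t| * nu x / c ^+ 2).
  by rewrite -!mulrA mulrCA; congr (_ * _); ring.
rewrite ler_wpM2l// ler_pdivlMr ?exprn_gt0//.
have := ler_wpM2l (ltW c0) dst; have := ler_wpM2l (normr_ge0 (s - t)) tx.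
by rewrite expr2; lra.
Qed.

Definition small e m (t : R) :=
  forall x, M x -> nu (scaled_iter t%:C%C (2 ^ m) x) <= e * nu x.

(** Let B_s and B_t be the powers at s and t, put x = y - B_s y, and let q' be the mean resolvent of
    x at t. Then B_s y = (y - q') + B_t q', where the two terms are at most 1/8 and 1/7 of the norm
    of x. Hence B_s halves norms, and two squarings bring the factor to 1/16, below 1/8; this costs
    the two in [m.+2]. *)
Lemma small_step m (s t : R) : 1 <= s <= B -> 1 <= t <= B ->
  2 * K / c ^+ 2 * `|s - t| <= 1 / 8 -> small (1 / 8) m t -> small (1 / 8) m.+2 s.
Proof.
move=> sB tB st sm.
have unit a : 1 <= a <= B -> 1 <= `|a%:C%C| :> R[i].
  move=> /andP[a1 _]; rewrite normc_def /= expr0n addr0 sqrtr_sqr.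
  by rewrite -(rmorph1 (real_complex R)) lecR ger0_norm// (le_trans ler01).
have [s1 t1] := (unit s sB, unit t tB).
have half y : M y -> nu (scaled_iter s%:C%C (2 ^ m) y) <= 1 / 2 * nu y.
  move=> My; set B' := scaled_iter s%:C%C (2 ^ m).
  pose x := y - B' y.
  have Mx : M x by apply: MD; rewrite // -scaleN1r; apply/MZ/scaled_iter_in.
  have [Mq qE] := mean_resolventP m s1 Mx; have [Mq' q'E] := mean_resolventP m t1 Mx.
  (* Both vectors are sent to x by I - B', which is injective on M. *)
  have qy : mean_resolvent m s%:C%C x = y.
    apply/eqP; rewrite -subr_eq0; apply/eqP; apply: (@scaled_iter_injective m s%:C%C) => //.
      by apply: MD; rewrite // -scaleN1r; exact: MZ.
    rewrite scaled_iter_add scaled_iterN.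
    set q := mean_resolvent m _ x; set Bq := scaled_iter _ _ q.
    have -> : q = y - B' y + Bq by rewrite -/x -[X in X + _]qE subrK.
    by rewrite [RHS]addrC -addrA addKr addrC.
  have := @mean_resolvent_lipschitz m 1 s t x (normr1 _) sB tB Mx.
  rewrite !mulr1 qy => sq.
  have q'x := sm _ Mq'; set q' := mean_resolvent m t%:C%C x in Mq' q'E sq q'x.
  have := ler_wpM2r (nu_ge0 nuP x) st.
  set Bq' := scaled_iter _ _ q' in q'E q'x.
  have := nuD nuP x Bq'; rewrite -[X in X + _]q'E subrK.
  have := nuD nuP (y - q') Bq'.
  have -> : y - q' + Bq' = B' y.
    have q'D : q' = x + Bq' by rewrite -[X in X + _]q'E subrK.
    by rewrite [X in y - X]q'D opprD addrA subrK subKr.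
  by have := nu_ge0 nuP y; have := nuB nuP y (B' y); rewrite -/x; lra.
have half4 y : M y -> nu (scaled_iter s%:C%C (2 ^ m.+1) y) <= 1 / 4 * nu y.
  move=> My; rewrite expnS mul2n -addnn scaled_iterD.
  have := half _ (scaled_iter_in s%:C%C (2 ^ m) My); have := half _ My; lra.
move=> x Mx; rewrite expnS mul2n -addnn scaled_iterD.
have := half4 _ (scaled_iter_in s%:C%C (2 ^ m.+1) Mx); have := half4 _ Mx.
by have := nu_ge0 nuP x; lra.
Qed.

Lemma small_ex : 1 <= B -> 8 * K <= B -> exists m, small (1 / 8) m 1.
Proof.
(* The step length d satisfies L d <= 1/8, as [small_step] demands; the points t k descend from B by
   steps of d and stop at 1. *)
move=> B1 BK; pose L := 2 * K / c ^+ 2; pose d := (8 * L + 1)^-1.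
have L0 : 0 <= L by apply: divr_ge0; [exact: mulr_ge0|exact/exprn_ge0/ltW].
have d0 : 0 < d by rewrite invr_gt0; lra.
pose t k : R := Num.max 1 (B - k%:R * d).
have tB k : 1 <= t k <= B.
  rewrite le_max lexx ge_max B1 /= lerBlDr lerDl mulr_ge0// ltW//.
have tS k : `|t k.+1 - t k| <= d.
  rewrite /t -natr1 mulrDl mul1r ler_norml /Num.max.
  by case: ltP => ?; case: ltP => ?; apply/andP; split; lra.
have [k kE] : exists k, t k = 1.
  have [k kB] : exists k : nat, B / d < k%:R.
    exists (Num.bound (B / d)); rewrite archi_boundP// divr_ge0 ?ltW//; lra.
  exists k; apply/max_idPl; move: kB; rewrite ltr_pdivrMr// => kB; lra.
suff : exists m, small (1 / 8) m (t k) by rewrite kE.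
elim: k {kE} => [|k [m mk]].
  (* At the starting point B >= 8 K the operator A / B already has norm at most 1/8. *)
  exists 0; rewrite /t mul0r subr0 (max_idPr B1) => x Mx.
  rewrite /scaled_iter expn0 expr1 /= -fmorphV (nuZ nuP).
  rewrite ger0_norm ?invr_ge0; last lra.
  rewrite ler_pdivrMl; last lra.
  apply: le_trans (AK x) _; have := ler_wpM2r (nu_ge0 nuP x) BK; lra.
exists m.+2; apply: (small_step (tB k.+1) (tB k) _ mk).
rewrite -/L; apply: (le_trans (ler_wpM2l L0 (tS k))).
by rewrite /d ler_pdivrMr; lra.
Qed.

End Resolvent.

Lemma spectral_contraction :
  exists m, forall x, M x -> nu (iter (2 ^ m) A x) <= 1 / 2 * nu x.
Proof.
have [r rP] := resolvent_ex.
have [c c0 cP] := uniformly_bounded_below (Num.max 1 (8 * K)) inv.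
have [||m sm] := small_ex rP c0 cP; rewrite ?le_max ?lexx ?orbT//.
exists m => x Mx; have := sm x Mx.
rewrite /scaled_iter rmorph1 expr1n invr1 scale1r.
by have := nu_ge0 nuP x; lra.
Qed.
End SpectralRadius.

Lemma geometric_small (R : realType) (C q e : R) : 0 <= q < 1 -> 0 < e ->
  exists n : nat, C * q ^+ n < e.
Proof.
move=> /andP[q0 q1] e0.
have /(@cvg_geometric R C)/cvgr_lt/(_ e e0)[n _ nP] : `|q| < 1 by rewrite ger0_norm.
by exists n; exact: (nP n (leqnn n)).
Qed.

(** * Projections onto closed complements *)

Section CompleteSpace.
Context {R : realType} {Y : completeNormedModType R}.

Lemma geometric_cvg (s : nat -> Y) (C q : R) : 0 <= q < 1 ->
  (forall n, `|s n.+1 - s n| <= C * q ^+ n) ->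
  exists l, forall n, `|l - s n| <= C / (1 - q) * q ^+ n.
Proof.
move=> q01 sC; have /andP[q0 q1] := q01.
have C0 : 0 <= C by have := sC 0; rewrite expr0 mulr1; apply: le_trans.
pose D := C / (1 - q); have D0 : 0 <= D by rewrite divr_ge0// subr_ge0 ltW.
have DC : C = D * (1 - q) by rewrite mulfVK// subr_eq0 gt_eqF.
have tail n k : `|s (n + k)%N - s n| <= D * q ^+ n - D * q ^+ (n + k).
  elim: k => [|k IH]; first by rewrite addn0 !subrr normr0.
  rewrite addnS (le_trans (ler_distD (s (n + k)%N) _ _))//.
  by have := sC (n + k)%N; rewrite DC exprS; lra.
have {}tail n k : (n <= k)%N -> `|s k - s n| <= D * q ^+ n.
  move=> /subnKC <-; rewrite (le_trans (tail _ _))// lerBlDr lerDl.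
  by rewrite mulr_ge0// exprn_ge0.
have : cvg (s @ \oo).
  apply/cauchy_cvgP/cauchy_exP => e e0.
  have [n nP] := geometric_small D q01 e0.
  exists (s n), n => // k /= /tail nk; rewrite -ball_normE /= distrC.
  exact: le_lt_trans nP.
move=> /cvg_ex[l sl]; exists l => n; apply/ler_addgt0Pr => e e0.
have /cvgrPdist_lt/(_ e e0)[k _ kP] := sl.
rewrite (le_trans (ler_distD (s (maxn n k)) _ _))// addrC lerD ?tail ?leq_maxl//.
exact/ltW/kP/leq_maxr.
Qed.

Definition real_subspace (M : set Y) :=
  [/\ M 0, forall x y, M x -> M y -> M (x + y) & forall (t : R) x, M x -> M (t *: x)].

Lemma closed_approx (M : set Y) x : closed M ->
  (forall e, 0 < e -> exists2 y, M y & `|x - y| < e) -> M x.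
Proof.
move=> Mc xM; apply: Mc => U /nbhs_ballP[e /= e0 eU].
by have [y My xy] := xM e e0; exists y; split=> //; apply: eU; rewrite -ball_normE.
Qed.

Context {M N : set Y} (Mc : closed M) (Nc : closed N).
Hypotheses (Ms : real_subspace M) (Ns : real_subspace N) (MN : @direct_sum R RealScalars Y M N).

Lemma direct_sum_unique m n m' n' :
  M m -> N n -> M m' -> N n' -> m + n = m' + n' -> m = m'.
Proof.
case: Ms Ns MN => _ MD MZ [_ ND NZ] [MN0 _] Mm Nn Mm' Nn' mn.
apply/eqP; rewrite -subr_eq0.
have mnE : m - m' = n' - n.
  by apply/eqP; rewrite subr_eq addrAC eq_sym subr_eq addrC mn addrC.
suff : (M `&` N) (m - m') by rewrite MN0 => /= ->.
split; first by apply: MD => //; rewrite -scaleN1r; exact: MZ.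
by rewrite mnE; apply: ND => //; rewrite -scaleN1r; exact: NZ.
Qed.

Lemma projection_ex : exists p : {linear Y -> Y},
  (forall x, M (p x)) /\ (forall x, N (x - p x)).
Proof.
case: MN => _ /choice[p pP].
have pM x : M (p x) by have [n []] := pP x.
have pN x : N (x - p x) by have [n [_ Nn {1}->]] := pP x; rewrite addrAC subrr add0r.
have pK x : p x + (x - p x) = x by rewrite addrC subrK.
case: Ms Ns => _ MD MZ [_ ND NZ].
have pl : linear p.
  move=> a x y; apply: (@direct_sum_unique _ (a *: x + y - p (a *: x + y)) _
    (a *: (x - p x) + (y - p y))) => //.
  - by apply: MD => //; exact: MZ.
  - by apply: ND => //; exact: NZ.
  - by rewrite pK addrACA -scalerDr !pK.
pose pL : {linear Y -> Y} := HB.pack p (GRing.isLinear.Build _ _ _ _ _ pl).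
by exists pL.
Qed.

Section Bounded.
Variable p : {linear Y -> Y}.
Hypotheses (pM : forall x, M (p x)) (pN : forall x, N (x - p x)).

(** The Baire half of an open mapping argument: every vector is approximated, up to half its norm,
    by one on which p is controlled. The iteration that removes the error is in
    [projection_bounded]. *)
Lemma projection_approx : exists2 C, 0 <= C &
  forall x, exists2 y, `|p y| <= C * `|x| & `|x - y| <= 1 / 2 * `|x|.
Proof.
pose E n := closure [set x : Y | `|p x| <= n%:R].
have [n [x0 [r r0 rE]]] : exists n x0, exists2 r : R, 0 < r & ball x0 r `<=` E n.
  have : exists n, ~ dense (~` E n).
    apply/existsNP => dE.
    have /(_ setT) : dense (\bigcap_n ~` E n).
      by apply: Baire => n; split; [exact/closed_openC/closed_closure|exact: dE].
    have T0 : [set: Y] !=set0 by exists 0.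
    case=> // [|x [_ xE]]; first exact: openT.
    apply: (xE (Num.bound `|p x|)) => //; apply: subset_closure.
    by rewrite /= ltW// archi_boundP.
  move=> [n /denseNE[W [ [x /open_nbhs_nbhs/nbhs_ballP[r r0 rW]] WE]]].
  exists n, x, r => // y /rW Wy; apply: contrapT => yE.
  by have : (W `&` ~` E n) y by []; rewrite WE.
(* Subtracting approximants of x0 + x and of x0 moves the ball to the origin and doubles the bound
   n. *)
have E_ball x e : `|x| < r -> 0 < e ->
    exists2 y, `|p y| <= 2 * n%:R & `|x - y| < e.
  move=> xr e0; have e2 : 0 < e / 2 by rewrite divr_gt0.
  have [|a [an ax]] := rE (x0 + x) _ _ (nbhsx_ballx _ _ e2).
    by rewrite -ball_normE /= opprD addNKr normrN.
  have [|b [bn bx]] := rE x0 _ _ (nbhsx_ballx _ _ e2).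
    by rewrite -ball_normE /= subrr normr0.
  rewrite /= in an bn; rewrite -ball_normE /= in ax bx.
  exists (a - b).
    by rewrite raddfB (le_trans (ler_normB _ _))//; lra.
  have -> : x - (a - b) = (x0 + x - a) - (x0 - b).
    by rewrite !opprB [RHS]addrC -(addrA x0) subrKA addrCA.
  by rewrite (le_lt_trans (ler_normB _ _))//; lra.
exists (4 * n%:R / r); first by rewrite divr_ge0 ?mulr_ge0// ltW.
move=> x; have [->|x0'] := eqVneq x 0.
  by exists 0; rewrite ?(raddf0 p) ?subrr normr0 ?mulr0.
have {x0'}xn : 0 < `|x| by rewrite normr_gt0.
pose t : R := r / (2 * `|x|); have t0 : 0 < t by rewrite divr_gt0// mulr_gt0.
have tx : t * `|x| = r / 2 by rewrite /t; field; rewrite gt_eqF.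
have txr : `|t *: x| < r by rewrite normrZ gtr0_norm// tx; lra.
have [|y pyn yx] := @E_ball _ (t * `|x| / 2) txr; first by apply: divr_gt0 => //; exact: mulr_gt0.
exists (t^-1 *: y).
  rewrite linearZ_LR normrZ gtr0_norm ?invr_gt0// ler_pdivrMl//.
  have -> : t * (4 * n%:R / r * `|x|) = 4 * n%:R / r * (t * `|x|) by ring.
  rewrite tx; apply: le_trans pyn _.
  by rewrite le_eqVlt; apply/orP; left; apply/eqP; field; rewrite gt_eqF.
rewrite -(ler_pM2l t0) -{1}(gtr0_norm t0) -normrZ scalerBr scalerA mulfV ?gt_eqF//.
by rewrite scale1r; lra.
Qed.

(** Repeated approximation leaves remainders [xs n] that halve each time, while p (x - xs n)
    converges geometrically to some l. As M and N are closed, l lies in M and x - l in N, so l = p x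
    by uniqueness of the decomposition. *)
Lemma projection_bounded : exists2 C, 0 <= C & forall x, `|p x| <= C * `|x|.
Proof.
have [C C0 pC] := projection_approx.
have /choice[f fP] x : exists y, `|p y| <= C * `|x| /\ `|x - y| <= 1 / 2 * `|x|.
  by have [y] := pC x; exists y.
have fp x := (fP x).1; have fx x := (fP x).2.
exists (2 * C); first by rewrite mulr_ge0.
move=> x; pose xs n := iter n (fun z => z - f z) x.
have xsn n : `|xs n| <= (1 / 2) ^+ n * `|x|.
  elim: n => [|n IH]; first by rewrite expr0 mul1r.
  by apply: le_trans (fx (xs n)) _; rewrite exprS; lra.
have half : 0 <= (1 / 2 : R) < 1 by apply/andP; split; lra.
have [|l ls] := @geometric_cvg (fun n => p (x - xs n)) (C * `|x|) (1 / 2) half.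
  move=> n; have -> : p (x - xs n.+1) - p (x - xs n) = p (f (xs n)).
    rewrite -(linearB p); congr (p _); rewrite /= -/(xs n).
    by rewrite !opprB addrC subrKA addrCA subrr addr0.
  apply: le_trans (fp (xs n)) _; have := ler_wpM2l C0 (xsn n); lra.
have lM : M l.
  apply: closed_approx => // e e0.
  have [n nP] := geometric_small (C * `|x| / (1 - 1 / 2)) half e0.
  by exists (p (x - xs n)) => //; exact: le_lt_trans nP.
have lN : N (x - l).
  apply: closed_approx => // e e0.
  have [n nP] := geometric_small (C * `|x| / (1 - 1 / 2) + `|x|) half e0.
  exists (x - xs n - p (x - xs n)) => //; apply: le_lt_trans nP.
  have -> : x - l - (x - xs n - p (x - xs n)) = xs n - (l - p (x - xs n)).
    by move: (p _) => c; rewrite !opprB (addrA c) [LHS]addrC subrKA [RHS]addrA (addrC c).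
  rewrite (le_trans (ler_normB _ _))// mulrDl addrC lerD//.
  by rewrite mulrC.
have -> : p x = l.
  apply: (@direct_sum_unique _ (x - p x) _ (x - l)) => //.
  by rewrite ![_ + (x - _)]addrC !subrK.
have := ls 0; rewrite /xs /= subrr raddf0 subr0 expr0 mulr1 => /le_trans; apply.
by rewrite le_eqVlt; apply/orP; left; apply/eqP; field.
Qed.
End Bounded.
End CompleteSpace.

(** * Contractions of bounded families *)

Lemma bootstrap_bound (R : realType) (I : Type) (f : I -> R) (s a r : R) :
  0 <= s < 1 -> (forall i, f i <= r) ->
  (forall t, (forall i, f i <= t) -> forall i, f i <= s * t + a) ->
  forall i, f i <= a / (1 - s).
Proof.
move=> s01 fr step i; have /andP[s0 s1] := s01.
(* The fixed point l of t |-> s t + a attracts the a priori bound r geometrically. *)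
pose l := a / (1 - s); have aE : a = l * (1 - s) by rewrite divfK// subr_eq0 gt_eqF.
apply/ler_addgt0Pr => e e0.
have [n nP] := geometric_small `|r - l| s01 e0.
suff fn k : forall j, f j <= l + `|r - l| * s ^+ k.
  by apply: le_trans (fn n i) _; rewrite lerD2l ltW.
elim: k => [|k IH] j.
  by rewrite expr0 mulr1 -lerBlDl (le_trans _ (ler_norm _))// lerB.
by apply: le_trans (step _ IH j) _; rewrite aE exprS; lra.
Qed.

Section FixedPoint.
Context {R : realType} {Y : completeNormedModType R} {I : Type}.
Context {nu : Y -> R} {C s b : R} {Phi : (I -> Y) -> I -> Y}.
Hypotheses (C0 : 0 <= C) (s01 : 0 <= s < 1).
Hypotheses (le_nu : forall y, `|y| <= C * nu y) (nu_le : forall y, nu y <= C * `|y|).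
Hypothesis Phi_contraction : forall u v r,
  (forall i, nu (u i - v i) <= r) -> forall i, nu (Phi u i - Phi v i) <= s * r.
Hypothesis Phi0 : forall i, nu (Phi (fun=> 0) i) <= b.

(** The contraction principle for bounded families, run pointwise in the complete space Y with rates
    independent of the index. The uniform approximation by iterates from 0 is kept because it is
    what transfers continuity to the fixed point. *)
Lemma uniform_fixpoint : exists u, [/\ Phi u = u, exists r, forall i, `|u i| <= r &
  forall e, 0 < e -> exists n, forall i, `|u i - iter n Phi (fun=> 0) i| < e].
Proof.
have /andP[s0 _] := s01; pose un n := iter n Phi (fun=> 0).
have unS n i : nu (un n.+1 i - un n i) <= b * s ^+ n.
  elim: n i => [|n IH] i; first by rewrite expr0 mulr1 /= subr0.
  by rewrite exprS mulrCA; apply: Phi_contraction.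
have /choice[u uP] i : exists l, forall n, `|l - un n i| <= C * b / (1 - s) * s ^+ n.
  apply: geometric_cvg => // n.
  by apply: le_trans (le_nu _) _; rewrite -mulrA ler_wpM2l.
have near_u e : 0 < e -> exists n, forall i, `|u i - un n i| < e.
  move=> e0; have [n nP] := geometric_small (C * b / (1 - s)) s01 e0.
  by exists n => i; exact: le_lt_trans nP.
exists u; split=> //.
- apply/funext => i; apply/eqP; rewrite -subr_eq0 -normr_le0; apply/ler_addgt0Pr => e e0.
  pose D := C * b / (1 - s).
  have [n nP] := geometric_small ((C * (s * C) + s) * D) s01 e0.
  rewrite add0r; apply/ltW/(le_lt_trans _ nP).
  rewrite (le_trans (ler_distD (un n.+1 i) _ _))// mulrDl mulrDl lerD//.
    have H : nu (Phi u i - un n.+1 i) <= s * (C * (D * s ^+ n)).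
      apply: Phi_contraction => j; apply: le_trans (nu_le _) _.
      by rewrite ler_wpM2l//; exact: uP.
    by apply: le_trans (le_nu _) _; have := ler_wpM2l C0 H; lra.
  by have := uP i n.+1; rewrite distrC exprS; rewrite -/D; lra.
- by exists (C * b / (1 - s)) => i; have := uP i 0; rewrite subr0 expr0 mulr1.
Qed.
End FixedPoint.

(** * Adapted norm *)

Section AdaptedNorm.
Context {R : realType} {Y : normedModType R}.

Lemma iter_linear (A : {linear Y -> Y}) n : linear (iter n A).
Proof. by elim: n => [|n IH] a x y //; rewrite !iterS IH linearP. Qed.

Lemma iter_norm_le (A : {linear Y -> Y}) (K : R) n x : 0 <= K ->
  (forall y, `|A y| <= K * `|y|) -> `|iter n A x| <= K ^+ n * `|x|.
Proof.
move=> K0 AK; elim: n => [|n IH]; first by rewrite mul1r.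
by apply: le_trans (AK _) _; rewrite exprS -mulrA ler_wpM2l.
Qed.

(* The sum over i <= n of s^(n - i) |A^i x| telescopes, so that one application
   of A contracts it by s once s^(n + 1) >= 1/2. *)
Lemma adapted_seminorm (A P : {linear Y -> Y}) (K : R) n : 0 <= K ->
  (forall x, `|A x| <= K * `|x|) -> (forall x, `|P x| <= K * `|x|) ->
  (forall x, P (A (P x)) = A (P x)) ->
  (forall x, `|iter n.+1 A (P x)| <= 1 / 2 * `|P x|) ->
  exists alpha : Y -> R, exists C s, [/\ 0 <= C, 0 <= s < 1 &
    [/\ forall x y, alpha (x + y) <= alpha x + alpha y,
        forall x, alpha (- x) = alpha x,
        forall x, `|P x| <= C * alpha x,
        forall x, alpha x <= C * `|P x| &
        forall x, alpha (A (P x)) <= s * alpha x]].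
Proof.
move=> K0 AK PK PAP An.
(* Bernoulli's inequality gives s^(n + 1) >= 1 - (n + 1) / (2 (n + 1)) = 1/2. *)
pose s : R := 1 - 1 / (2 * n.+1%:R).
have n0 : 0 < n.+1%:R :> R by [].
have /andP[d0 d1] : 0 < (1 / (2 * n.+1%:R) : R) <= 1 / 2.
  rewrite divr_gt0 ?mulr_gt0//= ler_pM2l// lef_pV2 ?posrE ?mulr_gt0//.
  by rewrite ler_peMr// ler1n.
have s01 : 0 <= s < 1 by rewrite /s; move: (1 / (2 * _)) d0 d1 => w ? ?; apply/andP; split; lra.
have /andP[s0 s1] := s01.
have sn k : (k <= n.+1)%N -> 1 / 2 <= s ^+ k.
  move=> kn; apply: le_trans (ler_wiXn2l s0 (ltW s1) kn).
  have bern m : 1 - m%:R * (1 / (2 * n.+1%:R)) <= s ^+ m.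
    elim: m => [|m IH]; first by rewrite mul0r subr0.
    rewrite exprS; apply: le_trans (ler_wpM2l s0 IH); rewrite /s -natr1.
    move: (1 / (2 * _)) d0 => w w0.
    by have := mulr_ge0 (ler0n R m) (sqr_ge0 w); rewrite expr2; lra.
  by apply: le_trans (bern n.+1); rewrite le_eqVlt; apply/orP; left; apply/eqP; field.
pose alpha x := \sum_(i < n.+1) s ^+ (n - i) * `|iter i A (P x)|.
exists alpha, (2 + \sum_(i < n.+1) K ^+ i), s; split=> //.
  by rewrite addr_ge0// sumr_ge0// => i _; exact: exprn_ge0.
split.
- move=> x y; rewrite -big_split ler_sum// => i _ /=.
  rewrite -mulrDr ler_wpM2l ?exprn_ge0// raddfD.
  by have := iter_linear A i 1 (P x) (P y); rewrite !scale1r => ->; exact: ler_normD.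
- move=> x; apply: eq_bigr => i _; rewrite raddfN.
  have := iter_linear A i (-1) (P x) 0; rewrite addr0 scaleN1r => ->.
  have -> : iter i A 0 = 0 by elim: (nat_of_ord i) => //= k ->; rewrite raddf0.
  by rewrite addr0 scaleN1r normrN.
- move=> x; have a0 : 1 / 2 * `|P x| <= alpha x.
    rewrite /alpha big_ord_recl /= subn0 -[leLHS]addr0 lerD//.
      by rewrite ler_wpM2r// sn.
    by rewrite sumr_ge0// => i _; rewrite mulr_ge0// exprn_ge0.
  have : 0 <= \sum_(i < n.+1) K ^+ i by rewrite sumr_ge0// => i _; exact: exprn_ge0.
  have := normr_ge0 (P x); nra.
- move=> x; rewrite mulrDl mulr_suml -[leLHS]add0r lerD ?mulr_ge0//.
  apply: ler_sum => i _; apply: le_trans _ (iter_norm_le i (P x) K0 AK).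
  by rewrite ler_piMl// exprn_ile1// ltW.
- move=> x; rewrite /alpha mulr_sumr PAP big_ord_recr /= subnn expr0 mul1r.
  rewrite [leRHS]big_ord_recl /= subn0 mulrA -exprS addrC lerD//.
    by rewrite -iterSr; apply: le_trans (An x) _; rewrite ler_wpM2r// sn.
  apply: ler_sum => i _.
  by rewrite mulrA -exprS /bump /= add1n add0n subnSK// -iterS iterSr.
Qed.

End AdaptedNorm.

(** [splitPT] and [splitPS] express that T preserves M and S preserves N. The block P T Q is left
    free: its vanishing is what separates hyperbolic from generalized hyperbolic operators. *)
Record splitting (R : realType) (Y : normedModType R) (T S P Q : {linear Y -> Y}) : Prop :=
  Splitting {
    splitTK : cancel T S ;
    splitSK : cancel S T ;
    splitQ : forall x, Q x = x - P x ;
    splitPP : forall x, P (P x) = P x ;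
    splitPT : forall x, P (T (P x)) = T (P x) ;
    splitPS : forall x, P (S (Q x)) = 0 ;
    split_bounded : exists2 K, 0 <= K & forall x,
      [/\ `|T x| <= K * `|x|, `|S x| <= K * `|x| & `|P x| <= K * `|x|] ;
    splitT_contraction : exists n, forall x, `|iter n.+1 T (P x)| <= 1 / 2 * `|P x| ;
    splitS_contraction : exists n, forall x,
      `|iter n.+1 S (Q x)| <= 1 / 2 * `|Q x| }.

Section Splitting.
Context {R : realType} {Y : completeNormedModType R} {T S P Q : {linear Y -> Y}}.
Hypothesis TSP : splitting T S P Q.

(** The norm is the maximum of the adapted seminorms of T on M and of S on N. As T (P x) has no
    N-part and S (Q y) no M-part, each seminorm sees only one summand, and the two contraction
    factors combine by a maximum instead of a sum. *)
Lemma adapted_norm : exists nu : Y -> R, exists C s, [/\ 0 <= C, 0 <= s < 1 &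
  [/\ forall x y, nu (x + y) <= nu x + nu y,
      forall x, `|x| <= C * nu x, forall x, nu x <= C * `|x| &
      forall x y r, nu x <= r -> nu y <= r -> nu (T (P x) + S (Q y)) <= s * r]].
Proof.
have [K K0 bd] := split_bounded TSP.
have QE := splitQ TSP.
have PQ x : P (Q x) = 0 by rewrite QE raddfB /= (splitPP TSP) subrr.
have QP x : Q (P x) = 0 by rewrite QE (splitPP TSP) subrr.
have [n /adapted_seminorm An] := splitT_contraction TSP.
have [m /(@adapted_seminorm _ _ S Q) Bm] := splitS_contraction TSP.
have [||||a [C [s [C0 s01 [aD aN Pa aP aA]]]]] := An K; rewrite //.
- by move=> x; case: (bd x).
- by move=> x; case: (bd x).
- exact: (splitPT TSP).
have [||||b [D [t [D0 t01 [bD bN Pb bP bA]]]]] := Bm (1 + K).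
- by rewrite addr_ge0.
- move=> x; have [_ H _] := bd x; apply: le_trans H _.
  by rewrite ler_wpM2r// lerDr.
- move=> x; have [_ _ H] := bd x; rewrite mulrDl mul1r.
  by rewrite QE (le_trans (ler_normB _ _))// lerD2l.
- by move=> x; rewrite [LHS]QE (splitPS TSP) subr0.
have /andP[s0 s1] := s01; have /andP[t0 t1] := t01.
have a0 x : P x = 0 -> a x <= 0 by move=> Px; have := aP x; rewrite Px normr0 mulr0.
have b0 x : Q x = 0 -> b x <= 0 by move=> Qx; have := bP x; rewrite Qx normr0 mulr0.
pose nu x := Num.max (a x) (b x).
have nua x : a x <= nu x by rewrite le_max lexx.
have nub x : b x <= nu x by rewrite le_max lexx orbT.
have a_ge0 x : 0 <= a x.
  have := aD x (- x); have := aP 0; have := aD 0 0.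
  by rewrite aN subrr addr0 raddf0 normr0 mulr0; lra.
have b_ge0 x : 0 <= b x.
  have := bD x (- x); have := bP 0; have := bD 0 0.
  by rewrite bN subrr addr0 raddf0 normr0 mulr0; lra.
have nu0 x : 0 <= nu x by rewrite (le_trans (a_ge0 x)).
exists nu, ((C + D) * (1 + K)), (Num.max s t); split=> //.
- by rewrite mulr_ge0// addr_ge0.
- by rewrite le_max s0 gt_max s1.
split.
- move=> x y; rewrite ge_max (le_trans (aD x y)) ?lerD//.
  by rewrite (le_trans (bD x y))// lerD.
- move=> x; rewrite -[x in `|x|](subrK (P x)) (le_trans (ler_normD _ _))//.
  have := Pa x; have := Pb x; rewrite -QE.
  have := ler_wpM2l C0 (nua x); have := ler_wpM2l D0 (nub x); have := nu0 x.
  move: (mulr_ge0 C0 K0) (mulr_ge0 D0 K0) => CK DK nux.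
  by have := mulr_ge0 (addr_ge0 CK DK) nux; lra.
- move=> x; have [_ _ PK] := bd x.
  have QK : `|Q x| <= (1 + K) * `|x|.
    by rewrite mulrDl mul1r QE (le_trans (ler_normB _ _))// lerD2l.
  have := ler_wpM2l C0 PK; have := ler_wpM2l D0 QK; have := aP x; have := bP x.
  have := normr_ge0 x => x0.
  have := mulr_ge0 C0 x0; have := mulr_ge0 D0 x0.
  have := mulr_ge0 C0 (mulr_ge0 K0 x0); have := mulr_ge0 D0 (mulr_ge0 K0 x0).
  by move=> *; rewrite ge_max; apply/andP; split; lra.
- move=> x y r xr yr; rewrite ge_max; apply/andP; split.
    apply: le_trans (aD _ _) _.
    have : a (S (Q y)) <= 0 by apply: a0; exact: (splitPS TSP).
    have : s * a x <= Num.max s t * r.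
      by apply: ler_pM; rewrite ?le_max ?lexx// (le_trans (nua x)).
    by have := aA x; lra.
  apply: le_trans (bD _ _) _.
  have : b (T (P x)) <= 0 by apply: b0; rewrite QE (splitPT TSP) subrr.
  have : t * b y <= Num.max s t * r.
    by apply: ler_pM; rewrite ?le_max ?lexx ?orbT// (le_trans (nub y)).
  by have := bA y; lra.
Qed.
End Splitting.

(** * Split solutions *)

Section SplitSolution.
Context {R : realType} {Y : completeNormedModType R} {T S P Q : {linear Y -> Y}}.
Hypothesis TSP : splitting T S P Q.

Lemma complementaryE x : Q x = x - P x. Proof. exact: (splitQ TSP). Qed.

Lemma projD x : x = P x + Q x.
Proof. by rewrite complementaryE addrC subrK. Qed.

Lemma proj_compl x : P (Q x) = 0.
Proof. by rewrite complementaryE (linearB P) (splitPP TSP) subrr. Qed.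

Lemma compl_proj x : Q (P x) = 0.
Proof. by rewrite complementaryE (splitPP TSP) subrr. Qed.

Lemma projSQ x : P (S (Q x)) = 0. Proof. exact: (splitPS TSP). Qed.

Lemma complTP x : Q (T (P x)) = 0.
Proof. by rewrite complementaryE (splitPT TSP) subrr. Qed.

Lemma complSQ x : Q (S (Q x)) = S (Q x).
Proof. by rewrite [LHS]complementaryE projSQ subr0. Qed.

Section Equation.
Context {Z : Type} (b d : Z -> Z).

(* For u (b z) = T (u z) + g z, the P-component is solved for u (b z) and the
   Q-component for u z. *)
Definition split_step (u g : Z -> Y) (z : Z) : Y :=
  (T (P (u (d z))) + S (Q (u (b z)))) + (P (g (d z)) - S (Q (g z))).

Definition split_solution (u g : Z -> Y) := forall z, u z = split_step u g z.

Lemma split_stepB u v g h z :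
  split_step u g z - split_step v h z =
  split_step (fun z => u z - v z) (fun z => g z - h z) z.
Proof.
rewrite /split_step !(linearB P, linearB Q, linearB T, linearB S) opprD addrACA; congr (_ + _).
  by rewrite opprD addrACA.
by rewrite !opprD !opprK addrACA.
Qed.

Lemma split_solutionD u v g h : split_solution u g -> split_solution v h ->
  split_solution (fun z => u z + v z) (fun z => g z + h z).
Proof.
move=> ug vh z; rewrite [in LHS]ug [in LHS]vh /split_step.
rewrite !(linearD P, linearD Q, linearD T, linearD S).
rewrite addrACA; congr (_ + _); first by rewrite addrACA.
by rewrite opprD addrACA.
Qed.

Hypotheses (bK : cancel b d) (dK : cancel d b).

(** The second identity forces T (Q (u z)) into the range of Q, which the plain equation u (b z) = T
    (u z) + g z does not imply. *)
Lemma split_solutionP u g z : split_solution u g ->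
  P (u (b z)) = T (P (u z)) + P (g z) /\ Q (u (b z)) = T (Q (u z)) + Q (g z).
Proof.
move=> ug; split.
  rewrite [in LHS]ug /split_step !(linearD P, linearN P) (splitPT TSP) (splitPP TSP).
  by rewrite !projSQ !addr0 subr0 bK.
rewrite [u z]ug /split_step !(linearD Q, linearN Q) complTP compl_proj !complSQ !add0r.
by rewrite (linearD T) (linearN T) !(splitSK TSP) subrK.
Qed.

Lemma split_solution_eq u g : split_solution u g -> forall z, u (b z) = T (u z) + g z.
Proof.
move=> /split_solutionP ug z; have [Pu Qu] := ug z.
by rewrite [LHS]projD Pu Qu addrACA -(linearD T) -!projD.
Qed.

(** When P T Q = 0 the projections commute with T, so the plain equation decouples into its two
    components. *)
Lemma eq_split_solution u g : (forall x, P (T (Q x)) = 0) ->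
  (forall z, u (b z) = T (u z) + g z) -> split_solution u g.
Proof.
move=> PTQ ubE z; rewrite /split_step.
have PT x : P (T x) = T (P x).
  by rewrite {1}[x]projD (linearD T) (linearD P) PTQ addr0 (splitPT TSP).
have QT x : Q (T x) = T (Q x) by rewrite !complementaryE PT (linearB T).
rewrite addrACA -PT -(linearD P) -ubE dK -(linearB S) -(linearB Q) ubE addrK.
by rewrite QT (splitTK TSP) -projD.
Qed.

End Equation.

(** Substitution along a semiconjugacy H. Since b and b' are inverted by d and d', H also
    intertwines the backward maps. *)
Lemma split_solution_comp (Z Z' : Type) (b d : Z -> Z) (b' d' : Z' -> Z') (H : Z' -> Z) u g :
  cancel b d -> cancel d' b' -> (forall z, H (b' z) = b (H z)) ->
  split_solution b d u g ->
  split_solution b' d' (fun z => u (H z)) (fun z => g (H z)).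
Proof.
move=> bK dK' Hb ug z; have Hd : H (d' z) = d (H z).
  by rewrite -[LHS]bK -Hb dK'.
by rewrite {1}ug /split_step Hb Hd.
Qed.

Lemma split_step_bound : exists nu : Y -> R, exists C s L,
  [/\ 0 <= C, 0 <= s < 1, 0 <= L, forall x, `|x| <= C * nu x &
  (forall x, nu x <= C * `|x|) /\
  forall (Z : Type) (b d : Z -> Z) u g r a,
    (forall z, nu (u z) <= r) -> (forall z, `|g z| <= a) ->
    forall z, nu (split_step b d u g z) <= s * r + L * a].
Proof.
have [nu [C [s [C0 s01 [nuD nu1 nu2 nuc]]]]] := adapted_norm TSP.
have [K K0 bd] := split_bounded TSP.
exists nu, C, s, (C * (K + K * (1 + K))).
have L0 : 0 <= C * (K + K * (1 + K)).
  by rewrite mulr_ge0// addr_ge0// mulr_ge0// addr_ge0.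
split=> //; split=> // Z b d u g r a ur ga z.
rewrite /split_step (le_trans (nuD _ _))// lerD//; first exact: nuc.
apply: le_trans (nu2 _) _; rewrite -mulrA ler_wpM2l//.
have [_ _ Pg] := bd (g (d z)); have [_ _ Pg'] := bd (g z).
have [_ SQg _] := bd (Q (g z)).
have := ler_wpM2l K0 (ga (d z)).
have := ler_wpM2l K0 (ler_wpM2l (addr_ge0 ler01 K0) (ga z)).
have H3 : `|Q (g z)| <= (1 + K) * `|g z|.
  by rewrite complementaryE (le_trans (ler_normB _ _))// mulrDl mul1r lerD2l.
have := ler_wpM2l K0 H3; have := ler_normB (P (g (d z))) (S (Q (g z))); lra.
Qed.

(* Any property of maps that contains 0 and is stable under the contraction
   holds for arbitrarily good uniform approximations of the solution; it is
   applied to continuity. *)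
Definition split_solvable (eps K : R) := forall (Z : Type) (b d : Z -> Z),
  (forall (g : Z -> Y -> Y) (B : R),
    (forall z x y, `|g z x - g z y| <= eps * `|x - y|) ->
    (forall z, `|g z 0| <= B) ->
    exists u, [/\ split_solution b d u (fun z => g z (u z)),
      exists r, forall z, `|u z| <= r &
      forall Good : (Z -> Y) -> Prop, Good (fun=> 0) ->
        (forall v, Good v -> Good (split_step b d v (fun z => g z (v z)))) ->
        forall e, 0 < e -> exists2 v, Good v & forall z, `|u z - v z| < e]) /\
  (forall u v g h e,
    split_solution b d u g -> split_solution b d v h ->
    (exists r, forall z, `|u z - v z| <= r) ->
    (forall z, `|g z - h z| <= eps * `|u z - v z| + e) ->
    forall z, `|u z - v z| <= K * e).

Lemma split_solvable_ex : exists eps K : R,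
  [/\ 0 < eps, 0 <= K & split_solvable eps K].
Proof.
have [nu [C [s [L [C0 /andP[s0 s1] L0 nu1 [nu2 nuS]]]]]] := split_step_bound.
(* This choice keeps s' = s + L (eps C), the contraction factor of the step with an eps-Lipschitz
   right-hand side, below 1. Neither Z nor b and d enter, hence neither does p. *)
pose eps := (1 - s) / (2 * (L * C) + 1).
have LC0 : 0 <= L * C by rewrite mulr_ge0.
have eps0 : 0 < eps by rewrite divr_gt0//; lra.
pose s' := s + L * (eps * C).
have s'1 : s' < 1.
  have : eps * (2 * (L * C) + 1) = 1 - s by rewrite divfK// gt_eqF//; lra.
  by rewrite /s'; have := mulr_ge0 (ltW eps0) LC0; lra.
have s'0 : 0 <= s' by rewrite /s'; have := mulr_ge0 (ltW eps0) LC0; lra.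
have s'01 : 0 <= s' < 1 by rewrite s'0.
exists eps, (C * (L / (1 - s'))); split=> //.
  by rewrite !mulr_ge0// invr_ge0 subr_ge0 ltW.
have epsC x r : nu x <= r -> eps * `|x| <= eps * C * r.
  move=> xr; rewrite -mulrA ler_pM2l// (le_trans (nu1 x))// ler_wpM2l//.
move=> Z b d; split=> [g B gL gB|u v g h e ug vh [r uvr] gh z].
  pose Phi v := split_step b d v (fun z => g z (v z)).
  have [|i|u [uP ur un]] := @uniform_fixpoint _ Y Z nu C s' (L * B) Phi C0 s'01 nu1 nu2.
  - move=> u v r uvr z; rewrite /Phi split_stepB.
    have -> : s' * r = s * r + L * (eps * C * r) by rewrite /s'; ring.
    apply: nuS => // w; apply: le_trans (gL _ _ _) _; exact: epsC.
  - rewrite /Phi -[leRHS]add0r -[X in X + _](mulr0 s); apply: nuS => // _.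
    by apply: le_trans (nu2 0) _; rewrite normr0 mulr0.
  exists u; split=> //; first by move=> z; rewrite -[in LHS]uP.
  move=> Good G0 GS e e0; have [n nP] := un e e0.
  by exists (iter n Phi (fun=> 0)) => //; elim: (n) => //= m; exact: GS.
apply: le_trans (nu1 _) _; rewrite -!mulrA ler_wpM2l// mulrA mulrAC.
apply: (@bootstrap_bound _ _ (fun z => nu (u z - v z)) s' _ (C * r)) => //.
  by move=> w; rewrite (le_trans (nu2 _))// ler_wpM2l.
move=> t uvt w; rewrite {1}ug {1}vh split_stepB.
have -> : s' * t + L * e = s * t + L * (eps * C * t + e) by rewrite /s'; ring.
by apply: nuS => // w'; rewrite (le_trans (gh _))// lerD2r; exact: epsC.
Qed.

End SplitSolution.

Arguments split_step {R Y} T S P Q {Z}.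
Arguments split_solution {R Y} T S P Q {Z}.
Arguments split_solvable {R Y} T S P Q.

(** * Continuity and inverses of perturbed operators *)

Section Continuity.
Context {R : realType} {Y : normedModType R}.

Lemma lipschitz_continuous (f : Y -> Y) (k : R) :
  (forall x y, `|f x - f y| <= k * `|x - y|) -> continuous f.
Proof.
move=> fk x; apply/cvgrPdist_lt => e e0; near=> y.
rewrite (le_lt_trans (fk x y))// (@le_lt_trans _ _ (`|k| * `|x - y|))//.
  by rewrite ler_wpM2r// ler_norm.
rewrite (@le_lt_trans _ _ ((`|k| + 1) * `|x - y|)) ?ler_wpM2r ?lerDl//.
rewrite -ltr_pdivlMl ?ltr_wpDl//; near: y.
by apply: cvgr_dist_lt => //; rewrite mulr_gt0 ?invr_gt0 ?ltr_wpDl.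
Unshelve. all: by end_near. Qed.

Lemma uniformly_approx_continuous (f : Y -> Y) :
  (forall e, 0 < e -> exists2 g, continuous g & forall x, `|f x - g x| < e) ->
  continuous f.
Proof.
move=> fg x; apply/cvgrPdist_lt => e e0.
have e3 : 0 < e / 3 by rewrite divr_gt0.
have [g gc fge] := fg _ e3.
have /cvgrPdist_lt/(_ _ e3) := gc x; apply: filterS => y gxy.
have := ler_distD (g x) (f x) (f y); have := ler_distD (g y) (g x) (f y).
have := fge x; have := fge y; rewrite (distrC (f y)); lra.
Qed.

Lemma linear_bounded (A : {linear Y -> Y}) : continuous A ->
  exists2 K, 0 <= K & forall x, `|A x| <= K * `|x|.
Proof.
move=> Ac; have /linear_boundedP : bounded_near A (nbhs (0 : Y)).
  by apply/linear_bounded_continuous.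
move=> [K [_ KP]]; exists (`|K| + 1); first by rewrite addr_ge0.
by apply: KP; rewrite ltr_pwDr// ler_norm.
Qed.

Lemma bounded_linear_continuous (A : {linear Y -> Y}) (K : R) :
  (forall x, `|A x| <= K * `|x|) -> continuous A.
Proof.
by move=> AK; apply: (@lipschitz_continuous _ K) => x y; rewrite -(linearB A).
Qed.

End Continuity.

Section PerturbedInverse.
Context {R : realType} {Y : completeNormedModType R} {T S : {linear Y -> Y}} {K : R}.
Hypotheses (TS : cancel T S) (ST : cancel S T) (K0 : 0 <= K).
Hypothesis SK : forall x, `|S x| <= K * `|x|.

(** The inverse is sought as S + w with w bounded: T S = I turns (T + L) (S y + w y) = y into w y =
    - S (L (S y + w y)), a contraction by 1/2 on families indexed by Y itself. *)
Lemma perturbed_inverse (L : Y -> Y) (e B : R) : e * K <= 1 / 2 ->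
  (forall x y, `|L x - L y| <= e * `|x - y|) -> (forall x, `|L x| <= B) ->
  exists D, [/\ cancel (T \+ L) D, cancel D (T \+ L) & continuous D].
Proof.
move=> eK Le LB.
pose Phi (w : Y -> Y) y := - S (L (S y + w y)).
have half : 0 <= (1 / 2 : R) < 1 by apply/andP; split; lra.
have SL x y : `|S (L x) - S (L y)| <= 1 / 2 * `|x - y|.
  rewrite -(linearB S); apply: le_trans (SK _) _.
  have := ler_wpM2l K0 (Le x y); have := ler_wpM2r (normr_ge0 (x - y)) eK; lra.
have [|||y|w [wE _ wn]] :=
  @uniform_fixpoint _ Y Y (fun y => `|y|) 1 (1 / 2) (K * B) Phi ler01 half.
- by move=> y; rewrite mul1r.
- by move=> y; rewrite mul1r.
- move=> u v r uvr y; rewrite /Phi -opprD normrN.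
  apply: le_trans (SL _ _) _; apply: ler_wpM2l; first lra.
  by rewrite opprD addrACA subrr add0r.
- by rewrite /Phi normrN (le_trans (SK _))// ler_wpM2l.
pose D y := S y + w y.
have DK : cancel D (T \+ L).
  move=> y; rewrite /= /D (linearD T) ST -{1}wE /Phi (linearN T) ST.
  by rewrite subrK.
have inj : injective (T \+ L).
  move=> x y /= xy; apply/eqP; rewrite -subr_eq0 -normr_le0.
  have : x - y = - (S (L x) - S (L y)).
    have : T x - T y = - (L x - L y).
      have -> : T x = T y + L y - L x by rewrite -xy addrK.
      by rewrite -(addrA (T y)) addrAC subrr add0r opprB.
    by move=> /(congr1 S); rewrite -(linearB T) TS (linearN S) (linearB S).
  by move=> /(congr1 Num.norm); rewrite normrN; have := SL x y; lra.
exists D; split=> //; first by move=> y; apply: inj; rewrite DK.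
apply: uniformly_approx_continuous => e0 e00; have [n nP] := wn _ e00.
exists (fun y => S y + iter n Phi (fun=> 0) y); last first.
  by move=> x; rewrite /D opprD addrACA subrr add0r.
have Sc : continuous S := bounded_linear_continuous SK.
have SLc : continuous (fun y => S (L y)) by apply: lipschitz_continuous SL.
elim: (n) => [|m IH] y /=; first by apply: cvgD; [exact: Sc|exact: cvg_cst].
apply: cvgD; first exact: Sc.
by apply: cvgN; exact: (continuous_comp (IH y) (SLc _)).
Qed.
End PerturbedInverse.

(** * The cyclic system *)

Lemma big_comp_intertwine (Y : Type) n (A : 'I_n -> Y -> Y) (k : nat -> Y -> Y)
    (B : Y -> Y) :
  (forall (j : 'I_n) y, A j (k j.+1 y) = k j (B y)) ->
  forall y, (\big[comp/idfun]_(j < n) A j) (k n y) = k 0 (iter n B y).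
Proof.
elim: n A k => [|n IH] A k Ak y; first by rewrite big_ord0.
rewrite big_ord_recl /= (IH (fun j => A (lift ord0 j)) (fun m => k m.+1)).
  exact: (Ak ord0).
by move=> j z; have := Ak (lift ord0 j) z.
Qed.

Section CyclicSystem.
Context {R : realType} {Y : completeNormedModType R} {T S P Q : {linear Y -> Y}}.
Hypothesis TSP : splitting T S P Q.
Context {n : nat}.
Local Notation Z := ('I_n.+1 * Y)%type.
Local Notation maps := ('I_n.+1 -> Y -> Y).

(** The index decreases because the relation A_j k_(j+1) = k_j B_j expresses k_j through k_(j+1): in
    the product the factor of largest index acts first. *)
Definition cycle_next (B : maps) (z : Z) : Z := (ord_pred z.1, B (ord_pred z.1) z.2).
Definition cycle_prev (D : maps) (z : Z) : Z := (ordS z.1, D z.1 z.2).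

Lemma cycle_nextK B D : (forall j, cancel (B j) (D j)) ->
  cancel (cycle_next B) (cycle_prev D).
Proof. by move=> BD [i y]; rewrite /cycle_next /cycle_prev /= ord_predK BD. Qed.

Lemma cycle_prevK B D : (forall j, cancel (D j) (B j)) ->
  cancel (cycle_prev D) (cycle_next B).
Proof. by move=> DB [i y]; rewrite /cycle_next /cycle_prev /= ordSK DB. Qed.

(* With k_i(y) = y + u(i, y), the equation u (b z) = T (u z) + defect L L' z (u z)
   reads (T + L_i) k_(i+1) = k_i (T + L'_i), indices modulo n + 1. *)
Definition defect (L L' : maps) (z : Z) (x : Y) : Y :=
  L (ord_pred z.1) (z.2 + x) - L' (ord_pred z.1) z.2.

Definition perturb (L : maps) : maps := fun j => T \+ L j.

Definition conjugacy_solution (L L' D' : maps) (u : Z -> Y) :=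
  [/\ split_solution T S P Q
        (cycle_next (perturb L')) (cycle_prev D') u (fun z => defect L L' z (u z)),
      exists r, forall z, `|u z| <= r & forall j, continuous (fun y => u (j, y))].

Lemma intertwines L L' D' u : (forall j, cancel (perturb L' j) (D' j)) ->
  conjugacy_solution L L' D' u ->
  forall j y, perturb L j (y + u (ordS j, y)) = perturb L' j y + u (j, perturb L' j y).
Proof.
move=> BD [us _ _] j y.
have := split_solution_eq TSP (cycle_nextK BD) us (ordS j, y).
rewrite /cycle_next /defect /= ordSK => ->.
rewrite /perturb /= (linearD T) -addrA -[in RHS]addrA; congr (_ + _).
by rewrite [RHS]addrCA; congr (_ + _); rewrite [RHS]addrC subrK.
Qed.

(** The sum is the displacement of the composite (I + u_j) (I + u'_j). The defects telescope, the
    terms in L' cancelling, so linearity and substitution of split solutions suffice. *)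
Lemma conjugacy_solution_comp L L' L'' D' D'' u u' :
  (forall j, cancel (perturb L' j) (D' j)) ->
  (forall j, cancel (D'' j) (perturb L'' j)) ->
  (forall j, cancel (perturb L'' j) (D'' j)) ->
  conjugacy_solution L L' D' u -> conjugacy_solution L' L'' D'' u' ->
  conjugacy_solution L L'' D''
    (fun z => u' z + u (z.1, z.2 + u' z)).
Proof.
move=> BD' DB'' BD'' us us'; have int := intertwines BD'' us'.
case: us us' => [us [r ur] uc] [us' [r' ur'] uc']; split.
- pose H (z : Z) : Z := (z.1, z.2 + u' z).
  have Hb z : H (cycle_next (perturb L'') z) = cycle_next (perturb L') (H z).
    by case: z => i y; rewrite /H /cycle_next /= -int ord_predK.
  have usH := split_solution_comp (cycle_nextK BD') (cycle_prevK DB'') Hb us.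
  move=> z; rewrite (split_solutionD us' usH z).
  congr (split_step T S P Q _ _ _ _ z); apply/funext => w.
  by rewrite /defect /= [LHS]addrC subrKA addrA.
- exists (r' + r) => z; by rewrite (le_trans (ler_normD _ _))// lerD.
- move=> j y; apply: cvgD; first exact: uc'.
  have yu' : {for y, continuous (fun y => y + u' (j, y))}.
    by apply: cvgD; [exact: cvg_id|exact: uc'].
  exact: (continuous_comp yu' (uc j _)).
Qed.

Context {K eps : R}.
Hypothesis solve : split_solvable T S P Q eps K.

Definition lipschitz_maps (L : maps) :=
  forall j x y, `|L j x - L j y| <= eps * `|x - y|.

Definition bounded_maps (L : maps) := exists B, forall j x, `|L j x| <= B.

Lemma conjugacy_solution_ex L L' D' : lipschitz_maps L -> bounded_maps L ->
  lipschitz_maps L' -> bounded_maps L' -> (forall j, continuous (D' j)) ->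
  exists u, conjugacy_solution L L' D' u.
Proof.
move=> Le [B LB] Le' [B' LB'] Dc.
have [ex _] := solve (cycle_next (perturb L')) (cycle_prev D').
have [||u [us ub uc]] := ex (defect L L') (B + B').
- move=> z x y; rewrite /defect opprB addrA subrK (le_trans (Le _ _ _))//.
  by rewrite opprD addrACA subrr add0r.
- by move=> z; rewrite /defect (le_trans (ler_normB _ _))// lerD.
have [K1 K10 bd] := split_bounded TSP.
have Tc : continuous T by apply: (@bounded_linear_continuous _ _ _ K1) => x; case: (bd x).
have Sc : continuous S by apply: (@bounded_linear_continuous _ _ _ K1) => x; case: (bd x).
have Pc : continuous P by apply: (@bounded_linear_continuous _ _ _ K1) => x; case: (bd x).
have Qc : continuous Q.
  have -> : (Q : Y -> Y) = (fun x => x - P x) by apply/funext => x; rewrite (splitQ TSP).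
  by move=> x; apply: cvgB; [exact: cvg_id|exact: Pc].
have comp (f g : Y -> Y) : continuous f -> continuous g -> continuous (fun y => g (f y)).
  by move=> fc gc y; apply: continuous_comp (fc y) (gc _).
have add (f g : Y -> Y) : continuous f -> continuous g -> continuous (fun y => f y + g y).
  by move=> fc gc y; apply: cvgD; [exact: fc|exact: gc].
have opp (f : Y -> Y) : continuous f -> continuous (fun y => - f y).
  by move=> fc y; apply: cvgN; exact: fc.
have idc : continuous (fun y : Y => y) by move=> y; exact: cvg_id.
have lipc (L0 : maps) j : lipschitz_maps L0 -> continuous (L0 j).
  by move=> L0e; apply: lipschitz_continuous (L0e j).
exists u; split=> // j.
apply: uniformly_approx_continuous => e e0.
(* Continuity must be propagated at all indices at once, since the step at i uses the values at
   [ordS i] and [ord_pred i]. *)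
have [||v vc uv] := uc (fun v => forall i, continuous (fun y => v (i, y))) _ _ e e0.
- by move=> i y; exact: cvg_cst.
- move=> v vc i; rewrite /split_step /cycle_next /cycle_prev /defect /=.
  have gc k : continuous (fun y => L (ord_pred k) (y + v (k, y)) - L' (ord_pred k) y).
    apply: (add (fun y => L (ord_pred k) (y + v (k, y)))); last exact: (opp _ (lipc _ _ Le')).
    exact: (comp _ _ (add _ _ idc (vc k)) (lipc _ _ Le)).
  have Bc : continuous (perturb L' (ord_pred i)) by exact: (add _ _ Tc (lipc _ _ Le')).
  apply: (add _ _ (add _ _ _ _) (add _ _ _ (opp _ _))).
  + exact: (comp _ _ (comp _ _ (comp _ _ (Dc i) (vc (ordS i))) Pc) Tc).
  + exact: (comp _ _ (comp _ _ (comp _ _ Bc (vc (ord_pred i))) Qc) Sc).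
  + by have := comp _ _ (comp _ _ (Dc i) (gc (ordS i))) Pc; rewrite /= ordSK.
  + exact: (comp _ _ (comp _ _ (gc i) Qc) Sc).
by exists (fun y => v (j, y)).
Qed.

(** With L' common to both sides the two equations live on the same dynamics and are directly
    comparable. Uniqueness is the case e = 0, the size of u the comparison with the zero
    solution. *)
Lemma conjugacy_solution_dist L1 L2 L' D' u v e : lipschitz_maps L1 ->
  (forall j x, `|L1 j x - L2 j x| <= e) ->
  conjugacy_solution L1 L' D' u -> conjugacy_solution L2 L' D' v ->
  forall z, `|u z - v z| <= K * e.
Proof.
move=> L1e Le [us [r ur] _] [vs [r' vr] _].
have [_] := solve (cycle_next (perturb L')) (cycle_prev D'); apply; [exact: us|exact: vs| |].
  by exists (r + r') => z; rewrite (le_trans (ler_normB _ _))// lerD.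
move=> z; rewrite /defect opprB addrA subrK.
apply: le_trans (ler_distD (L1 (ord_pred z.1) (z.2 + v z)) _ _) _.
rewrite lerD//; apply: le_trans (L1e _ _ _) _.
by rewrite opprD addrACA subrr add0r.
Qed.

Lemma conjugacy_solution_unique L L' D' u v : lipschitz_maps L ->
  conjugacy_solution L L' D' u -> conjugacy_solution L L' D' v -> u = v.
Proof.
move=> Le us vs; apply/funext => z; apply/eqP.
rewrite -subr_eq0 -normr_le0 -(mulr0 K).
by apply: conjugacy_solution_dist us vs z => // j x; rewrite subrr normr0.
Qed.

Lemma conjugacy_solution0 L D : conjugacy_solution L L D (fun=> 0).
Proof.
split; last by move=> j y; exact: cvg_cst.
  move=> z; rewrite /split_step.
  have d0 w : defect L L w 0 = 0 by rewrite /defect addr0 subrr.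
  by rewrite !d0 !(linear0 P, linear0 Q, linear0 S, linear0 T) subr0 !addr0.
by exists 0 => z; rewrite normr0.
Qed.

Lemma conjugacy_solution_bound L D' u B : lipschitz_maps L -> (forall j x, `|L j x| <= B) ->
  conjugacy_solution L (fun _ _ => 0) D' u -> forall z, `|u z| <= K * B.
Proof.
move=> Le LB us z; rewrite -[u z]subr0.
apply: conjugacy_solution_dist Le _ us (conjugacy_solution0 _ _) z => j x.
by rewrite subr0.
Qed.

Section Homeomorphism.
Context {L D : maps}.
Hypotheses (Le : lipschitz_maps L) (Lb : bounded_maps L) (eps0 : 0 <= eps).
Hypotheses (LD : forall j, cancel (perturb L j) (D j)).
Hypotheses (DL : forall j, cancel (D j) (perturb L j)).
Hypotheses (Dc : forall j, continuous (D j)).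

Lemma conjugates_of_solution u : conjugacy_solution L (fun _ _ => 0) (fun=> S) u ->
  @conjugates R RealScalars Y (fun y => y + u (ord0, y))
    (@perturbed_product R RealScalars Y T n.+1 L) (iter n.+1 T).
Proof.
move=> us; pose O : maps := fun _ _ => 0.
have Oe : lipschitz_maps O by move=> j x y; rewrite subrr normr0 mulr_ge0.
have Ob : bounded_maps O by exists 0 => j x; rewrite normr0.
have TS j : cancel (perturb O j) S by move=> x; rewrite /perturb /= addr0 (splitTK TSP).
have ST j : cancel S (perturb O j) by move=> x; rewrite /perturb /= addr0 (splitSK TSP).
have [v vs] := conjugacy_solution_ex Oe Ob Le Lb Dc.
have uv : (fun z => v z + u (z.1, z.2 + v z)) = fun=> 0.
  apply: (conjugacy_solution_unique Le _ (conjugacy_solution0 _ D)).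
  by apply: conjugacy_solution_comp us vs.
have vu : (fun z => u z + v (z.1, z.2 + u z)) = fun=> 0.
  apply: (conjugacy_solution_unique Oe _ (conjugacy_solution0 _ (fun=> S))).
  by apply: conjugacy_solution_comp vs us.
have cont w : (forall j, continuous (fun y => w (j, y))) ->
    continuous (fun y : Y => y + w (ord0 : 'I_n.+1, y)).
  by move=> wc y; apply: cvgD; [exact: cvg_id|exact: wc].
exists (fun y => y + v (ord0, y)); split.
  split.
  - by move=> y; rewrite -addrA; have /(congr1 (@^~ (ord0, y))) /= -> := vu; rewrite addr0.
  - by move=> y; rewrite -addrA; have /(congr1 (@^~ (ord0, y))) /= -> := uv; rewrite addr0.
  - by apply: cont; case: us.
  - by apply: cont; case: vs.
apply/funext => x /=.
have [y ->] : exists y, x = y + u (ord0, y).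
  exists (x + v (ord0, x)); rewrite -addrA.
  by have /(congr1 (@^~ (ord0, x))) /= -> := uv; rewrite addr0.
have -> : y + u (ord0, y) + v (ord0, y + u (ord0, y)) = y.
  by rewrite -addrA; have /(congr1 (@^~ (ord0, y))) /= -> := vu; rewrite addr0.
(* Natural indices read modulo n + 1: the family closes up as k (n + 1) = k 0, so the telescoped
   product conjugates by a single map. *)
pose k m (y : Y) := y + u (inord (m %% n.+1), y).
have k0 : k 0 = fun y => y + u (ord0, y).
  by apply/funext => z; rewrite /k mod0n; congr (_ + u (_, _)); apply/val_inj; rewrite /= inordK.
have kn : k n.+1 = k 0 by rewrite /k modnn mod0n.
have key j z : perturb L j (k j.+1 z) = k j (T z).
  have := intertwines TS us j z; rewrite {2 3}/perturb /= addr0 /k.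
  have -> : inord (j.+1 %% n.+1) = ordS j by apply/val_inj; rewrite /= inordK ?ltn_mod.
  by have -> : inord (j %% n.+1) = j by rewrite modn_small// inord_val.
by have := big_comp_intertwine key y; rewrite kn k0.
Qed.

End Homeomorphism.

(* The other k_j are recovered from k_0 = h by k_j = (T + L_j) k_(j+1) S. *)
Lemma solution_of_conjugacy L h : (forall x, P (T (Q x)) = 0) -> bounded_maps L ->
  (exists r, forall y, `|h y - y| <= r) -> continuous h ->
  (forall y, @perturbed_product R RealScalars Y T n.+1 L (h y) = h (iter n.+1 T y)) ->
  lipschitz_maps L ->
  exists2 u, conjugacy_solution L (fun _ _ => 0) (fun=> S) u &
    h = fun y => y + u (ord0, y).
Proof.
move=> PTQ [B LB] [r hr] hc hF Le.
(* [kk m] is k_(n+1-m): the recursion descends from k_(n+1) = h, and [kk0] closes the cycle because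
   h conjugates the whole product. *)
pose kk := fix kk m (y : Y) : Y :=
  if m is m'.+1 then perturb L (inord (n - m')) (kk m' (S y)) else h y.
have key (j : 'I_n.+1) y : perturb L j (kk (n.+1 - j.+1)%N y) = kk (n.+1 - j)%N (T y).
  have jn : (j <= n)%N by rewrite -ltnS.
  by rewrite subSS (subSn jn) [RHS]/= (splitTK TSP) (subKn jn) inord_val.
have kk0 : kk n.+1 = kk 0.
  apply/funext => y; have <- : iter n.+1 T (iter n.+1 S y) = y.
    by elim: n.+1 => // m IH; rewrite iterSr iterS (splitSK TSP).
  have := @big_comp_intertwine _ _ (perturb L) (fun m => kk (n.+1 - m)%N) T key (iter n.+1 S y).
  by rewrite subnn subn0 => <-; rewrite -[RHS]hF.
have [K1 K10 bd] := split_bounded TSP.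
have B0 : 0 <= B by rewrite (le_trans (normr_ge0 (L ord0 0))).
have kk_bounded M : exists2 t, 0 <= t & forall m y, (m <= M)%N -> `|kk m y - y| <= t.
  elim: M => [|M [t t0 IH]].
    exists r => [|m y]; first by rewrite (le_trans (normr_ge0 (h 0 - 0))).
    by rewrite leqn0 => /eqP ->; exact: hr.
  exists (t + (K1 * t + B)); first by rewrite addr_ge0// addr_ge0// mulr_ge0.
  move=> m y; rewrite leq_eqVlt => /predU1P[->|mM]; last first.
    by rewrite (le_trans (IH m y mM))// lerDl addr_ge0// mulr_ge0.
  rewrite -[leLHS]add0r lerD//= /perturb /= addrAC.
  rewrite -{2}(splitSK TSP y) -(linearB T) (le_trans (ler_normD _ _))// lerD//.
  have [TK _ _] := bd (kk M (S y) - S y).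
  by rewrite (le_trans TK)// ler_wpM2l// IH.
have Tc : continuous T by apply: (@bounded_linear_continuous _ _ _ K1) => x; case: (bd x).
have Sc : continuous S by apply: (@bounded_linear_continuous _ _ _ K1) => x; case: (bd x).
have kkc m : continuous (kk m).
  elim: m => [//|m IH] y; rewrite /= /perturb.
  have Skk : {for y, continuous (fun y => kk m (S y))}.
    exact: (continuous_comp (Sc y) (IH _)).
  apply: (continuous_comp Skk); apply: cvgD; first exact: Tc.
  exact: (lipschitz_continuous (Le _)).
exists (fun z : Z => kk (n.+1 - z.1)%N z.2 - z.2); last first.
  have E : kk (n.+1 - @ord0 n)%N = h by rewrite subn0 kk0.
  apply/funext => y; transitivity (y + (h y - y)); first by rewrite addrC subrK.
  by rewrite -E.
split.
- have dK : cancel (cycle_prev (fun=> S)) (cycle_next (perturb (fun _ _ => 0))).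
    by apply: cycle_prevK => j x; rewrite /perturb /= addr0 (splitSK TSP).
  apply: (eq_split_solution TSP dK PTQ) => -[i y].
  change (kk (n.+1 - ord_pred i)%N (T y + 0) - (T y + 0) =
    T (kk (n.+1 - i)%N y - y) +
    (L (ord_pred i) (y + (kk (n.+1 - i)%N y - y)) - 0)).
  have kki : kk (n.+1 - (ord_pred i).+1)%N = kk (n.+1 - i)%N.
    rewrite -{2}(ord_predK i); move: (ord_pred i) => j /=.
    have := ltn_ord j; rewrite leq_eqVlt => /predU1P[|] jn; last by rewrite modn_small.
    by rewrite jn modnn subnn subn0 kk0.
  rewrite !addr0 subr0 [y + _]addrC subrK -key kki.
  by rewrite (linearB T) addrAC.
- have [t _ tP] := kk_bounded n.+1.
  by exists t => z; apply: tP; rewrite leq_subr.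
- by move=> j y; apply: cvgB; [exact: kkc|exact: cvg_id].
Qed.

End CyclicSystem.

Arguments lipschitz_maps {R Y n} eps.
Arguments conjugacy_solution {R Y} T S P Q {n}.

(** * Spectral dichotomy *)

Section DirectSumResolvent.
Context {R : realType} {V : preTopologicalLmodType R[i]} {nu : V -> R}.
Hypothesis nuP : compatible_norm nu.

Lemma within_comp_nu (M : set V) (F f : V -> V) (K : R) x e :
  {within M, continuous F} -> (forall x, M (f x)) ->
  (forall x y, nu (f x - f y) <= K * nu (x - y)) -> 0 < e ->
  exists2 d, 0 < d & forall y, nu (y - x) < d -> nu (F (f y) - F (f x)) < e.
Proof.
move=> /subspace_continuousP/(_ (f x)) Fc fM fK e0.
have /(Fc (fM x)) : nbhs (F (f x)) [set y | nu (y - F (f x)) < e].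
  by apply/(nbhs_nu nuP); exists e.
rewrite /within /= => /(nbhs_nu nuP)[d d0 dF].
have K1 : 0 < `|K| + 1 by rewrite ltr_wpDl.
exists (d / (`|K| + 1)); first by rewrite divr_gt0.
move=> y; rewrite ltr_pdivlMr// => yx; apply: (dF (f y)) (fM y).
apply: le_lt_trans (fK _ _) _; apply: le_lt_trans yx.
by have := nu_ge0 nuP (y - x); have := ler_norm K; nra.
Qed.

Context {T S : {linear V -> V}} {M N : set V} {P : V -> V} {K : R}.
Hypotheses (TS : cancel T S) (ST : cancel S T).
Hypotheses (MD : forall x y, M x -> M y -> M (x + y)).
Hypotheses (MZ : forall (l : R[i]) x, M x -> M (l *: x)).
Hypotheses (ND : forall x y, N x -> N y -> N (x + y)).
Hypotheses (NZ : forall (l : R[i]) x, N x -> N (l *: x)).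
Hypotheses (MN : forall x, M x -> N x -> x = 0).
Hypotheses (PM : forall x, M (P x)) (PN : forall x, N (x - P x)).
Hypotheses (SK : forall x, nu (S x) <= K * nu x).
Hypotheses (PK : forall x y, nu (P x - P y) <= K * nu (x - y)).
Hypotheses (TM : forall x, M x -> M (T x)) (TN : forall x, N x -> N (T x)).
Hypotheses (SN : forall x, N x -> N (S x)).

(** On N one has T - l = - l T (S - l^-1), so the resolvent of S at l^-1 composed with - l^-1 S
    inverts T - l there; P glues this to the inverse F on M. *)
Lemma resolvent_of_direct_sum (l : R[i]) : l != 0 ->
  (exists F, inverse_on M (fun x => T x - l *: x) F) ->
  (exists F, inverse_on N (fun x => S x - l^-1 *: x) F) ->
  exists F, inverse_on [set: V] (fun x => T x - l *: x) F.
Proof.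
move=> l0 [F [_ MF FK KF Fc]] [G [_ NG GK KG Gc]].
have K0 : forall x, 0 <= K * nu x by move=> x; rewrite (le_trans _ (SK x))// nu_ge0.
have Peq x m n : M m -> N n -> x = m + n -> P x = m.
  move=> Mm Nn xmn; apply/eqP; rewrite -subr_eq0; apply/eqP; apply: MN.
    by apply: MD => //; rewrite -scaleN1r; exact: MZ.
  have -> : P x - m = n - (x - P x) 
    by rewrite [X in n - (X - _)]xmn opprB addrCA opprD [n + _]addrCA subrr addr0.
  by apply: ND => //; rewrite -scaleN1r; exact: NZ.
pose g x := - l^-1 *: S (x - P x).
have gN x : N (g x) by apply/NZ/SN.
have gK x y : nu (g x - g y) <= (taxicab (- l^-1) * (`|K| * (1 + `|K|))) * nu (x - y).
  rewrite /g -scalerBr -(linearB S) (le_trans (nu_taxicab nuP _ _))// -mulrA.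
  rewrite ler_wpM2l ?addr_ge0//.
  rewrite (le_trans (SK _))// (@le_trans _ _ (`|K| * nu (x - P x - (y - P y))))//.
    by rewrite ler_wpM2r ?nu_ge0// ler_norm.
  rewrite -mulrA ler_wpM2l// opprD addrACA -opprD.
  rewrite (le_trans (nuB nuP _ _))// mulrDl mul1r lerD2l.
  by rewrite (le_trans (PK _ _))// ler_wpM2r ?nu_ge0// ler_norm.
exists (fun x => F (P x) + G (g x)); split=> //.
- move=> x _; pose n := x - P x.
  have Tx : T x - l *: x = (T (P x) - l *: P x) + (T n - l *: n).
    rewrite -[x in LHS](subrK (P x)) -/n (linearD T) scalerDr opprD addrACA.
    by rewrite addrC.
  have Mx : M (T (P x) - l *: P x).
    by apply: MD; [exact: TM|rewrite -scaleN1r; apply: MZ; exact: MZ].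
  have Nn : N n by exact: PN.
  have Nx : N (T n - l *: n).
    by apply: ND; [exact: TN|rewrite -scaleN1r; apply: NZ; exact: NZ].
  have PTx := Peq _ _ _ Mx Nx Tx.
  have -> : g (T x - l *: x) = S n - l^-1 *: n.
    rewrite /g PTx Tx addrAC subrr add0r (linearB S) TS (linearZ_LR S).
    by rewrite scalerBr scalerA mulNr mulVf// scaleN1r opprK addrC scaleNr.
  by rewrite PTx FK ?inE// GK ?inE// addrC subrK.
- move=> x _; have Gx : S (G (g x)) - l^-1 *: G (g x) = g x by apply: KG; rewrite inE.
  have Fx : T (F (P x)) - l *: F (P x) = P x by apply: KF; rewrite inE.
  rewrite (linearD T) scalerDr opprD addrACA Fx.
  suff -> : T (G (g x)) - l *: G (g x) = x - P x by rewrite addrC subrK.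
  have : - l *: T (S (G (g x)) - l^-1 *: G (g x)) = - l *: T (g x) by rewrite Gx.
  rewrite (linearB T) ST (linearZ_LR T) scalerBr scalerA mulNr mulfV// scaleN1r opprK.
  rewrite addrC scaleNr => ->.
  by rewrite /g (linearZ_LR T) ST scalerA mulrNN mulfV// scale1r.
- apply: continuous_subspaceT => x U /(nbhs_nu nuP)[e e0 eU].
  apply/(nbhs_nu nuP); have e2 : 0 < e / 2 by rewrite divr_gt0.
  have [d1 d10 H1] := within_comp_nu x Fc PM PK e2.
  have [d2 d20 H2] := within_comp_nu x Gc gN gK e2.
  exists (Num.min d1 d2); first by rewrite lt_min d10.
  move=> y; rewrite lt_min => /andP[/H1 y1 /H2 y2]; apply: eU.
  rewrite opprD addrACA (le_lt_trans (nuD nuP _ _))//; lra.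
Qed.

End DirectSumResolvent.

Section FixedVector.
Context {R : realType} {Y : completeNormedModType R} {T S P : {linear Y -> Y}}.
Context {M N : set Y}.
Hypotheses (TS : cancel T S) (ST : cancel S T).
Hypotheses (Ms : real_subspace M) (Ns : real_subspace N).
Hypotheses (MN : forall x, M x -> N x -> x = 0).
Hypotheses (PM : forall x, M (P x)) (PN : forall x, N (x - P x)).
Hypotheses (SN : forall x, N x -> N (S x)).
Hypothesis Tsurj : forall y, M y -> exists2 b, M b & T b - b = y.
Hypothesis Ssurj : forall y, N y -> exists2 a, N a & S a - a = y.

(* The vector x is homoclinic: T^k x lies in M for k > 0 and in N for k <= 0;
   v is the sum of T^k x over all integers k. *)
Lemma fixed_vector x0 : N x0 -> ~ N (T x0) -> exists2 v, v != 0 & T v = v.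
Proof.
case: Ms Ns => _ MD MZ [N0 ND NZ] Nx0 NTx0.
have MN' x : M x -> M (- x) by rewrite -scaleN1r; exact: MZ.
have NN' x : N x -> N (- x) by rewrite -scaleN1r; exact: NZ.
(* Correcting x0 by S (T x0 - P (T x0)), a vector of N, puts the image exactly into M. *)
pose x := S (P (T x0)).
have Tx : T x = P (T x0) by rewrite ST.
have Nx : N x.
  have -> : x = x0 - S (T x0 - P (T x0)).
    by rewrite (linearB S) TS opprB addrCA subrr addr0.
  by apply: ND => //; apply/NN'/SN.
(* b stands for the sum of T^k x over k > 0 and a for the sum over k <= 0, both obtained by solving
   an equation instead of summing a series. *)
have [b Mb bE] := Tsurj (MN' _ (PM (T x0))).
have [a Na aE] := Ssurj (NN' _ Nx).
have xE : x = a - S a by rewrite -[LHS]opprK -aE opprB.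
exists (a + b); last first.
  have Tb : T b = b - T x by rewrite Tx -bE addrC subrK.
  have Ta : T a = a + T x by rewrite xE (linearB T) ST addrC subrK.
  by rewrite (linearD T) Ta Tb addrACA subrr addr0.
apply/eqP => /eqP; rewrite addr_eq0 => /eqP ab.
have a0 : a = 0 by apply: MN => //; rewrite ab; exact: MN'.
apply: NTx0; rewrite -[T x0]subr0.
have -> : 0 = P (T x0) by rewrite -Tx xE a0 !(linear0 S, subrr, linear0 T).
exact: PN.
Qed.
End FixedVector.

(** * The claims over a real Banach space *)

Section SupNorm.
Context {R : realType} {Y : normedModType R}.
Local Notation sup_norm := (@sup_norm R RealScalars Y).
Local Notation Lip := (@Lip R RealScalars Y).

Lemma sup_norm_lt_le (F : Y -> Y) (e : R) :
  (sup_norm F < e%:E)%E -> forall x, `|F x| <= e.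
Proof.
move=> Fe x; rewrite -lee_fin; apply: le_trans (ltW Fe).
by apply: ereal_sup_ubound; exists x.
Qed.

Lemma sup_norm_lt_bounded (F : Y -> Y) :
  (sup_norm F < +oo)%E -> exists B, forall x, `|F x| <= B.
Proof.
move=> Foo; exists (fine (sup_norm F)) => x.
have Fx : ((`|F x|)%:E <= sup_norm F)%E by apply: ereal_sup_ubound; exists x.
rewrite -lee_fin fineK// fin_num_abs; case: (sup_norm F) Fx Foo => //= r _ _.
by rewrite ltey.
Qed.

Lemma sup_norm_le (F : Y -> Y) (B : R) : (forall x, `|F x| <= B) ->
  (sup_norm F <= B%:E)%E.
Proof. by move=> FB; apply: ge_ereal_sup => _ [x _ <-]; rewrite lee_fin; exact: FB. Qed.

Lemma Lip_lt_le (F : Y -> Y) (e : R) :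
  (Lip F < e%:E)%E -> forall x y, `|F x - F y| <= e * `|x - y|.
Proof.
move=> Fe x y; have [->|xy] := eqVneq x y; first by rewrite !subrr !normr0 mulr0.
rewrite -ler_pdivrMr ?normr_gt0 ?subr_eq0// -lee_fin; apply: le_trans (ltW Fe).
by apply: ereal_sup_ubound; exists (x, y) => //=; apply/eqP.
Qed.
End SupNorm.

Definition conjugacy_claims (R : realType) (k : base_field)
    (X : normedModType (scalars R k)) (hyp : Prop)
    (adm : forall p, ('I_p -> X -> X) -> Prop)
    (sol : forall p, ('I_p -> X -> X) -> (X -> X) -> Prop) : Prop :=
  [/\ forall (p : nat) (L : 'I_p -> X -> X), (0 < p)%N ->
        adm p L -> exists h, sol p L h,
      forall (p : nat) (L : 'I_p -> X -> X), (0 < p)%N ->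
        adm p L -> ((exists! h, sol p L h) <-> hyp)
    & forall p : nat, (0 < p)%N ->
        exists H : ('I_p -> X -> X) -> (X -> X),
          (forall L, adm p L -> sol p L (H L)) /\
          (forall gamma : R, (0 < gamma)%R ->
            exists eta : R, (0 < eta)%R /\
              forall L L' : 'I_p -> X -> X, adm p L -> adm p L' ->
                (forall j, sup_norm (L j \- L' j)%R < eta%:E)%E ->
                (sup_norm (H L \- H L')%R < gamma%:E)%E)].

(* Abstracting [hyperbolic T] to hyp makes the statements over X and over its
   realification convertible. *)
Definition conjugacy_theorem (R : realType) (k : base_field)
    (X : normedModType (scalars R k)) (T : X -> X) (hyp : Prop) : Prop :=
  (exists eps : R, (0 < eps)%R /\
    @conjugacy_claims R k X hyp
      (fun p L => forall j, (sup_norm (L j) < +oo)%E /\ (Lip (L j) < eps%:E)%E)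
      (fun p L h => conjugates h (perturbed_product T L) (iter p T) /\
        (sup_norm (h \- idfun)%R < +oo)%E)) /\
  (forall delta : R, (0 < delta)%R -> exists eps : R, (0 < eps)%R /\
    @conjugacy_claims R k X hyp
      (fun p L => forall j, (sup_norm (L j) < eps%:E)%E /\ (Lip (L j) < eps%:E)%E)
      (fun p L h => conjugates h (perturbed_product T L) (iter p T) /\
        (sup_norm (h \- idfun)%R < delta%:E)%E)).

Section Claims.
Context {R : realType} {Y : completeNormedModType R} {T S P Q : {linear Y -> Y}}.
Hypothesis TSP : splitting T S P Q.
Context {K1 : R} (K10 : 0 <= K1) (SK1 : forall x, `|S x| <= K1 * `|x|).
Context {K eps : R} (K0 : 0 <= K) (eps0 : 0 < eps).
Hypothesis solve : split_solvable T S P Q eps K.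
Hypothesis epsK1 : eps * K1 <= 1 / 2.
Context {hyp : Prop}.
Hypotheses (hypP : hyp -> forall x, P (T (Q x)) = 0)
           (nhypP : ~ hyp -> exists2 v, v != 0 & T v = v).

Local Notation conjugates := (@conjugates R RealScalars Y).
Local Notation prod L := (@perturbed_product R RealScalars Y T _ L).

(** The distinguished conjugacies. A [nice] tuple has exactly one, hyperbolic or not, and it
    supplies the uniformly continuous choice. *)
Definition stable n (L : 'I_n.+1 -> Y -> Y) (h : Y -> Y) := exists2 u,
  conjugacy_solution T S P Q L (fun _ _ => 0) (fun=> S) u &
  h = fun y => y + u (ord0, y).

Definition nice n (L : 'I_n.+1 -> Y -> Y) := lipschitz_maps eps L /\ bounded_maps L.

Lemma stable_ex n (L : 'I_n.+1 -> Y -> Y) : nice L -> exists h, stable L h.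
Proof.
move=> [Le Lb]; have Sc : continuous S := bounded_linear_continuous SK1.
have [|||u us] :=
  conjugacy_solution_ex TSP solve Le Lb _ _ (D' := fun=> S) (L' := fun _ _ => 0).
- by move=> j x y; rewrite subrr normr0 mulr_ge0// ltW.
- by exists 0 => j x; rewrite normr0.
- by [].
by exists (fun y => y + u (ord0, y)), u.
Qed.

Lemma stable_conjugates n (L : 'I_n.+1 -> Y -> Y) h : nice L -> stable L h ->
  conjugates h (prod L) (iter n.+1 T).
Proof.
move=> [Le [B LB]] [u us ->].
have /choice[D DP] j : exists D,
    [/\ cancel (T \+ L j) D, cancel D (T \+ L j) & continuous D].
  exact: (perturbed_inverse (splitTK TSP) (splitSK TSP) K10 SK1 epsK1 (Le j) (LB j)).
apply: (conjugates_of_solution TSP solve Le _ (ltW eps0) _ _ _ us (D := D)).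
- by exists B.
- by move=> j; case: (DP j).
- by move=> j; case: (DP j).
- by move=> j; case: (DP j).
Qed.

Lemma stable_bound n (L : 'I_n.+1 -> Y -> Y) h B : nice L -> stable L h ->
  (forall j x, `|L j x| <= B) -> forall y, `|h y - y| <= K * B.
Proof.
move=> [Le _] [u us ->] LB y; rewrite addrAC subrr add0r.
exact: (conjugacy_solution_bound solve Le LB us).
Qed.

Lemma stable_dist n (L L' : 'I_n.+1 -> Y -> Y) h h' e : nice L ->
  stable L h -> stable L' h' ->
  (forall j x, `|L j x - L' j x| <= e) -> forall y, `|h y - h' y| <= K * e.
Proof.
move=> [Le _] [u us ->] [u' us' ->] LB y; rewrite opprD addrACA subrr add0r.
exact: (conjugacy_solution_dist solve Le LB us us').
Qed.

Lemma conjugates_stable n (L : 'I_n.+1 -> Y -> Y) h r : hyp -> nice L ->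
  conjugates h (prod L) (iter n.+1 T) -> (forall y, `|h y - y| <= r) -> stable L h.
Proof.
move=> /hypP PTQ [Le Lb] [g [[hg gh hc gc] Fh]] hr.
apply: (solution_of_conjugacy TSP PTQ Lb _ hc _ Le); first by exists r.
by move=> y; rewrite Fh /= hg.
Qed.

(** Translation by a fixed vector commutes with T and its iterates, so it can be absorbed into h. *)
Lemma conjugates_translate n (L : 'I_n.+1 -> Y -> Y) h w : T w = w ->
  conjugates h (prod L) (iter n.+1 T) ->
  conjugates (fun y => h (y + w)) (prod L) (iter n.+1 T).
Proof.
move=> Tw [g [[hg gh hc gc] ->]]; exists (fun y => g y - w); split.
  split.
  - by move=> y; rewrite hg addrK.
  - by move=> y; rewrite subrK gh.
  - move=> y; have wc : {for y, continuous (fun y => y + w)}.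
      by apply: cvgD; [exact: cvg_id|exact: cvg_cst].
    exact: (continuous_comp wc (hc _)).
  - by move=> y; apply: cvgB; [exact: gc|exact: cvg_cst].
have iterD m x y : iter m T (x + y) = iter m T x + iter m T y.
  by elim: m => // m IH; rewrite !iterS IH (linearD T).
have iterw m : iter m T w = w by elim: m => // m IH; rewrite iterS IH.
apply/funext => x; rewrite -[LHS]/(h (iter n.+1 T (g x))).
by rewrite -{1}(subrK w (g x)) iterD iterw.
Qed.

(** The margin t in the last hypothesis lets a small translate of a stable conjugacy remain
    admissible, so that non-uniqueness can be shown within the prescribed distance from the
    identity. *)
Lemma claims_of (adm : forall p, ('I_p -> Y -> Y) -> Prop) (close : (Y -> Y) -> Prop) :
  (forall n (L : 'I_n.+1 -> Y -> Y), adm n.+1 L -> nice L) ->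
  (forall h, close (h \- idfun) -> exists r, forall y, `|h y - y| <= r) ->
  (forall n (L : 'I_n.+1 -> Y -> Y) h, adm n.+1 L -> stable L h ->
    exists2 t, 0 < t &
      forall w, `|w| <= t -> close ((fun y => h (y + w)) \- idfun)) ->
  @conjugacy_claims R RealScalars Y hyp adm (fun p L h =>
    conjugates h (prod L) (iter p T) /\ close (h \- idfun)).
Proof.
move=> admN closeB closeS.
have sol n (L : 'I_n.+1 -> Y -> Y) h : adm n.+1 L -> stable L h ->
    conjugates h (prod L) (iter n.+1 T) /\ close (h \- idfun).
  move=> La Lh; split; first by apply: stable_conjugates => //; exact: admN.
  have [t t0 /(_ 0)] := closeS n L h La Lh; rewrite normr0 => /(_ (ltW t0)).
  by congr (close (_ \- _)); apply/funext => y; rewrite addr0.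
split.
- move=> [//|n] L _ La; have [h Lh] := stable_ex (admN _ _ La).
  by exists h; exact: sol.
- move=> [//|n] L _ La; have [h Lh] := stable_ex (admN _ _ La).
  have [hc hB] := sol _ _ _ La Lh; split=> [[h0 [_ h0u]]|Hy].
    apply: contrapT => /nhypP[v v0 Tv].
    have [t t0 tS] := closeS n L h La Lh.
    pose w := (t / `|v|) *: v.
    have vn : 0 < `|v| by rewrite normr_gt0.
    have wt : `|w| = t by rewrite normrZ gtr0_norm ?divr_gt0// divfK// gt_eqF.
    have Tw : T w = w by rewrite (linearZ_LR T) Tv.
    have hw : h = fun y => h (y + w).
      apply: etrans (esym (h0u h (conj hc hB))) _; apply: h0u.
      split; first exact: conjugates_translate.
      by apply: tS; rewrite wt.
    case: hc => g [[hg _ _ _] _].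
    have /(congr1 g) : h 0 = h (0 + w) by rewrite {1}hw.
    by rewrite !hg add0r => w0; move: t0; rewrite -wt -w0 normr0 ltxx.
  exists h; split; first exact: sol.
  move=> h' [h'c /closeB[r h'r]].
  have Lh' := conjugates_stable Hy (admN _ _ La) h'c h'r.
  apply/funext => y; apply/eqP; rewrite -subr_eq0 -normr_le0 -(mulr0 K).
  by apply: (stable_dist (admN _ _ La) Lh Lh') => j x; rewrite subrr normr0.
- move=> [//|n] _.
  have /choice[H HP] (L : 'I_n.+1 -> Y -> Y) : exists h, adm n.+1 L -> stable L h.
    have [La|nLa] := pselect (adm n.+1 L); last by exists idfun => /nLa.
    by have [h Lh] := stable_ex (admN _ _ La); exists h.
  exists H; split=> [L La|gamma g0]; first by apply: sol => //; exact: HP.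
  (* K + 1 in place of K is nonzero and makes the final inequality strict. *)
  exists (gamma / (K + 1)); have K1' : 0 < K + 1 by rewrite ltr_wpDl.
  split=> [|L L' La La' LL']; first by rewrite divr_gt0.
  have d0 : 0 < gamma / (K + 1) by rewrite divr_gt0.
  have KE : (gamma / (K + 1)) * (K + 1) = gamma by rewrite divfK// gt_eqF.
  apply: (@le_lt_trans _ _ (K * (gamma / (K + 1)))%:E); last by rewrite lte_fin; lra.
  apply: sup_norm_le => y; apply: (stable_dist (admN _ _ La) (HP _ La) (HP _ La')) => j x.
  exact: (sup_norm_lt_le (LL' j)).
Qed.

End Claims.

Arguments stable {R Y} T S P Q {n}.
Arguments nice {R Y} eps {n}.

Lemma conjugacy_of_splitting (R : realType) (Y : completeNormedModType R)
    (T S P Q : {linear Y -> Y}) (hyp : Prop) : splitting T S P Q ->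
  (hyp -> forall x, P (T (Q x)) = 0) ->
  (~ hyp -> exists2 v, v != 0 & T v = v) ->
  @conjugacy_theorem R RealScalars Y T hyp.
Proof.
move=> TSP hypP nhypP.
have [eps1 [K [eps10 K0 solve1]]] := split_solvable_ex TSP.
have [K1 K10 bd] := split_bounded TSP.
have SK1 x : `|S x| <= K1 * `|x| by case: (bd x).
(* The second bound gives eps K1 <= 1/2, under which every T + L_j is a homeomorphism. *)
pose eps := Num.min eps1 (1 / (2 * (K1 + 1))).
have K11 : 0 < K1 + 1 by rewrite ltr_wpDl.
have eps0 : 0 < eps by rewrite lt_min eps10 divr_gt0// mulr_gt0.
have eps1le : eps <= eps1 by rewrite ge_min lexx.
have epsK1 : eps * K1 <= 1 / 2.
  have : eps <= 1 / (2 * (K1 + 1)) by rewrite ge_min lexx orbT.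
  by rewrite ler_pdivlMr ?mulr_gt0// => ?; have := ltW eps0; nra.
have mono (a : R) : 0 <= a -> eps * a <= eps1 * a by move=> a0; rewrite ler_wpM2r.
have solve : split_solvable T S P Q eps K.
  move=> Z b d; have [ex un] := solve1 Z b d; split.
    move=> g B gL gB; apply: ex gB => z x y.
    exact: le_trans (gL z x y) (mono _ (normr_ge0 _)).
  move=> u v g h e us vs uvr gh; apply: un us vs uvr _ => z.
  exact: le_trans (gh z) (lerD (mono _ (normr_ge0 _)) (lexx e)).
have claims := claims_of TSP K10 SK1 K0 eps0 solve epsK1 hypP nhypP.
have translate n (L : 'I_n.+1 -> Y -> Y) h B w : nice eps L ->
    (forall j x, `|L j x| <= B) ->
    stable T S P Q L h ->
    (@sup_norm R RealScalars Y ((fun y => h (y + w)%R) \- idfun)%R <= (K * B + `|w|)%:E)%E.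
  move=> Ln LB Lh; apply: sup_norm_le => y /=.
  rewrite (le_trans (ler_distD (y + w) _ _))// lerD//.
    exact: (stable_bound solve Ln Lh LB).
  by rewrite addrAC subrr add0r.
split.
  have nice_adm n (L : 'I_n.+1 -> Y -> Y) :
      (forall j, @sup_norm R RealScalars Y (L j) < +oo /\
        @Lip R RealScalars Y (L j) < eps%:E)%E -> nice eps L.
    move=> La; split; first by move=> j; apply: Lip_lt_le; case: (La j).
    have /choice[b bL] j : exists B, forall x, `|L j x| <= B.
      by apply: sup_norm_lt_bounded; case: (La j).
    exists (\sum_j `|b j|) => j x; apply: le_trans (bL j x) _.
    rewrite (bigD1 j)//= (le_trans (ler_norm _))// lerDl.
    exact: sumr_ge0.
  exists eps; split=> //; apply: (claims _ (fun f => @sup_norm R RealScalars Y f < +oo)%E).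
  - exact: nice_adm.
  - by move=> h /sup_norm_lt_bounded.
  - move=> n L h /nice_adm Ln Lh; have [_ [B LB]] := Ln; exists 1 => // w _.
    exact: le_lt_trans (translate _ _ _ _ w Ln LB Lh) (ltry _).
(* The conjugacy may move points by delta / 4 and the translation by another delta / 4, which stays
   strictly below delta. *)
move=> delta delta0; pose eps' := Num.min eps (delta / (4 * (K + 1))).
have K1' : 0 < K + 1 by rewrite ltr_wpDl.
have eps'0 : 0 < eps' by rewrite lt_min eps0 divr_gt0// mulr_gt0.
have Keps' : K * eps' <= delta / 4.
  have : eps' <= delta / (4 * (K + 1)) by rewrite ge_min lexx orbT.
  by rewrite ler_pdivlMr ?mulr_gt0// => ?; have := ltW eps'0; nra.
have nice_adm n (L : 'I_n.+1 -> Y -> Y) :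
    (forall j, @sup_norm R RealScalars Y (L j) < eps'%:E /\
      @Lip R RealScalars Y (L j) < eps'%:E)%E ->
    nice eps L /\ forall j x, `|L j x| <= eps'.
  move=> La; have LB j x : `|L j x| <= eps' by apply: sup_norm_lt_le; case: (La j).
  split=> //; split; last by exists eps'.
  move=> j x y; have [_ /Lip_lt_le Lj] := La j; apply: le_trans (Lj x y) _.
  by rewrite ler_wpM2r// ge_min lexx.
exists eps'; split=> //; apply: (claims _ (fun f => @sup_norm R RealScalars Y f < delta%:E)%E).
- by move=> n L /nice_adm[].
- by move=> h /sup_norm_lt_le hd; exists delta.
- move=> n L h /nice_adm[Ln LB] Lh; exists (delta / 4); first by rewrite divr_gt0.
  move=> w wd; apply: le_lt_trans (translate _ _ _ _ w Ln LB Lh) _.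
  by rewrite lte_fin; lra.
Qed.

Section ConjugacyOfDichotomy.
Context {R : realType} {Y : completeNormedModType R} {T S : {linear Y -> Y}} {M N : set Y}.
Hypotheses (TS : cancel T S) (ST : cancel S T) (Tc : continuous T) (Sc : continuous S).
Hypotheses (Mc : closed M) (Nc : closed N) (Ms : real_subspace M) (Ns : real_subspace N).
Hypothesis MN : @direct_sum R RealScalars Y M N.
Hypotheses (TM : forall x, M x -> M (T x)) (SN : forall x, N x -> N (S x)).
Hypothesis Tcontr : exists n, forall x, M x -> `|iter n.+1 T x| <= 1 / 2 * `|x|.
Hypothesis Scontr : exists n, forall x, N x -> `|iter n.+1 S x| <= 1 / 2 * `|x|.
Hypothesis Tsurj : forall y, M y -> exists2 b, M b & T b - b = y.
Hypothesis Ssurj : forall y, N y -> exists2 a, N a & S a - a = y.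
Context {hyp : Prop}.
Hypothesis hyp_fixed : hyp -> forall v, T v = v -> v = 0.
Hypothesis hypI : forall P : {linear Y -> Y},
  (forall x, M (P x)) -> (forall x, N (x - P x)) -> continuous P ->
  (forall x, N x -> N (T x)) -> hyp.

Lemma conjugacy_of_dichotomy : @conjugacy_theorem R RealScalars Y T hyp.
Proof.
have [P [PM PN]] := projection_ex Ms Ns MN.
have [C C0 PC] := projection_bounded Mc Nc Ms Ns MN PM PN.
have [KT KT0 TK] := linear_bounded Tc; have [KS KS0 SK] := linear_bounded Sc.
pose Q : {linear Y -> Y} := idfun \- P.
have [M0 MD MZ] := Ms; have [N0 ND NZ] := Ns.
have Pid x : M x -> P x = x.
  move=> Mx; apply: (direct_sum_unique Ms Ns MN (PM x) (PN x) Mx N0).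
  by rewrite addrC subrK addr0.
have P0 x : N x -> P x = 0.
  move=> Nx; apply: (direct_sum_unique Ms Ns MN (PM x) (PN x) M0 Nx).
  by rewrite addrC subrK add0r.
have TSP : splitting T S P Q.
  split=> //.
  - by move=> x; apply: Pid.
  - by move=> x; apply/Pid/TM.
  - by move=> x; apply/P0/SN/PN.
  - exists (KT + KS + C); first by rewrite !addr_ge0.
    by move=> x; split; [move: (TK x)|move: (SK x)|move: (PC x)];
      move/le_trans; apply; rewrite ler_wpM2r//; lra.
  - by have [n nT] := Tcontr; exists n => x; exact/nT/PM.
  - by have [n nS] := Scontr; exists n => x; exact/nS/PN.
have MN0 x : M x -> N x -> x = 0 by move=> Mx Nx; rewrite -(Pid x Mx) P0.
have dich x0 : N x0 -> ~ N (T x0) -> exists2 v, v != 0 & T v = v.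
  exact: (fixed_vector TS ST Ms Ns MN0 PM PN SN Tsurj Ssurj).
apply: (conjugacy_of_splitting TSP).
- move=> Hy x; apply: P0; apply: contrapT => /(dich _ (PN x))[v v0 Tv].
  by move: v0; rewrite (hyp_fixed Hy Tv) eqxx.
- move=> nh; have /existsNP[x /not_implyP[Nx NTx]] : ~ forall x, N x -> N (T x).
    apply: contra_not nh; apply: (hypI PM PN).
    exact: bounded_linear_continuous PC.
  exact: dich Nx NTx.
Qed.
End ConjugacyOfDichotomy.

(** * Both scalar fields *)

(* V stands for Y itself over complex scalars and for the complexification of Y
   over real ones. *)
Section ConjugacyOfSpectra.
Context {R : realType} {Y : completeNormedModType R} {T S : {linear Y -> Y}} {M N : set Y}.
Hypotheses (TS : cancel T S) (ST : cancel S T) (Tc : continuous T) (Sc : continuous S).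
Hypotheses (Mc : closed M) (Nc : closed N) (Ms : real_subspace M) (Ns : real_subspace N).
Hypothesis MN : @direct_sum R RealScalars Y M N.
Hypotheses (TM : forall x, M x -> M (T x)) (SN : forall x, N x -> N (S x)).

Context {V : preTopologicalLmodType R[i]} {nu : V -> R} {emb : Y -> V} {pr : V -> Y}.
Context {TV SV : {linear V -> V}} {MV NV : set V} {K : R}.
Hypotheses (nuP : compatible_norm nu) (K0 : 0 <= K).
Hypotheses (pr_emb : cancel emb pr) (emb0 : emb 0 = 0).
Hypothesis prB : {morph pr : x y / x - y}.
Hypotheses (nu_emb : forall x, nu (emb x) = `|x|).
Hypotheses (embT : forall x, emb (T x) = TV (emb x)) (embS : forall x, emb (S x) = SV (emb x)).
Hypotheses (prT : forall z, pr (TV z) = T (pr z)) (prS : forall z, pr (SV z) = S (pr z)).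
Hypotheses (TSV : cancel TV SV) (STV : cancel SV TV).
Hypotheses (TVK : forall z, nu (TV z) <= K * nu z) (SVK : forall z, nu (SV z) <= K * nu z).
Hypotheses (MV0 : MV 0) (MVD : forall x y, MV x -> MV y -> MV (x + y)).
Hypothesis MVZ : forall (l : R[i]) x, MV x -> MV (l *: x).
Hypotheses (NV0 : NV 0) (NVD : forall x y, NV x -> NV y -> NV (x + y)).
Hypothesis NVZ : forall (l : R[i]) x, NV x -> NV (l *: x).
Hypothesis MNV : forall z, MV z -> NV z -> z = 0.
Hypotheses (embM : forall x, M x -> MV (emb x)) (prM : forall z, MV z -> M (pr z)).
Hypotheses (embN : forall x, N x -> NV (emb x)) (prN : forall z, NV z -> N (pr z)).
Hypotheses (TMV : forall z, MV z -> MV (TV z)) (SNV : forall z, NV z -> NV (SV z)).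
Hypothesis TNV : (forall x, N x -> N (T x)) -> forall z, NV z -> NV (TV z).
Hypothesis projV : forall P : {linear Y -> Y},
  (forall x, M (P x)) -> (forall x, N (x - P x)) -> continuous P ->
  exists PV : V -> V, exists C, [/\ forall z, MV (PV z), forall z, NV (z - PV z) &
    forall x y, nu (PV x - PV y) <= C * nu (x - y)].
Hypothesis specT : complex_spectrum MV TV `<=` [set l | `|l| < 1].
Hypothesis specS : complex_spectrum NV SV `<=` [set l | `|l| < 1].

Lemma spectrum_inverse (U : set V) (A : V -> V) (l : R[i]) :
  complex_spectrum U A `<=` [set l | `|l| < 1] -> 1 <= `|l| ->
  exists F, inverse_on U (fun x => A x - l *: x) F.
Proof.
move=> sA l1; apply: contrapT => /sA /= l2.
by have := le_lt_trans l1 l2; rewrite ltxx.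
Qed.

Lemma restricted_contraction (U : set Y) (UV : set V) (A : {linear Y -> Y})
    (AV : {linear V -> V}) :
  UV 0 -> (forall x y, UV x -> UV y -> UV (x + y)) ->
  (forall (l : R[i]) x, UV x -> UV (l *: x)) -> (forall z, UV z -> UV (AV z)) ->
  (forall z, nu (AV z) <= K * nu z) -> (forall x, U x -> UV (emb x)) ->
  (forall x, emb (A x) = AV (emb x)) ->
  complex_spectrum UV AV `<=` [set l | `|l| < 1] ->
  exists n, forall x, U x -> `|iter n.+1 A x| <= 1 / 2 * `|x|.
Proof.
move=> U0 UD UZ AU AK embU embA sA.
have [m mP] := spectral_contraction nuP U0 UD UZ AU AK
  (fun l l1 => spectrum_inverse sA l1) K0.
exists (2 ^ m).-1 => x Ux; rewrite prednK ?expn_gt0//.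
have := mP _ (embU x Ux); rewrite -!nu_emb.
suff -> : forall k, emb (iter k A x) = iter k AV (emb x) by [].
by elim=> // k IH; rewrite !iterS embA IH.
Qed.

(** The scalar 1 lies outside the open disc, so the equation is solved in V and the solution brought
    back by [pr]. *)
Lemma restricted_surjective (U : set Y) (UV : set V) (A : {linear Y -> Y})
    (AV : {linear V -> V}) :
  (forall x, U x -> UV (emb x)) -> (forall z, UV z -> U (pr z)) ->
  (forall z, pr (AV z) = A (pr z)) ->
  complex_spectrum UV AV `<=` [set l | `|l| < 1] ->
  forall y, U y -> exists2 b, U b & A b - b = y.
Proof.
move=> embU prU prA sA y Uy.
have [|F [_ FU _ KF _]] := @spectrum_inverse _ _ 1 sA; first by rewrite normr1.
have Uey := embU y Uy; exists (pr (F (emb y))); first exact/prU/FU.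
have := KF (emb y); rewrite inE => /(_ Uey) /(congr1 pr).
by rewrite pr_emb scale1r prB prA.
Qed.

Lemma conjugacy_of_spectra : @conjugacy_theorem R RealScalars Y T
  (invertible_operator T /\ complex_spectrum [set: V] TV `&` [set l | `|l| = 1] = set0).
Proof.
apply: (conjugacy_of_dichotomy TS ST Tc Sc Mc Nc Ms Ns MN TM SN).
- exact: (restricted_contraction MV0 MVD MVZ TMV TVK embM embT specT).
- exact: (restricted_contraction NV0 NVD NVZ SNV SVK embN embS specS).
- exact: (restricted_surjective embM prM prT specT).
- exact: (restricted_surjective embN prN prS specS).
- move=> [_ sp] v Tv.
  have [F [_ _ FK _ _]] : exists F, inverse_on [set: V] (fun x => TV x - 1 *: x) F.
    apply: contrapT => n1; have : (set0 : set R[i]) 1 by rewrite -sp; split=> //=; rewrite normr1.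
    by [].
  have Fz z : TV z = z -> F 0 = z.
    by move=> Tz; have := FK z; rewrite Tz scale1r subrr inE; apply.
  have ev : emb v = 0 by rewrite -(Fz (emb v)) -?embT ?Tv// (Fz 0)// linear0.
  by rewrite -(pr_emb v) ev -emb0 pr_emb.
- move=> P PM PN Pc TN.
  split.
    split=> //; exists S; split=> //; try by move=> x _; rewrite ?TS ?ST.
    exact: continuous_subspaceT.
  (* On the unit circle both l and l^-1 avoid the open disc, so the resolvents of T on M and of S on
     N exist and can be glued. *)
  have [PV [C [PMV PNV PVC]]] := projV PM PN Pc.
  rewrite -subset0 => l [/= nl l1]; apply: nl.
  have l0 : l != 0 by rewrite -normr_gt0 l1.
  have KC x y : nu (PV x - PV y) <= (K + `|C|) * nu (x - y).
    rewrite (le_trans (PVC x y))// ler_wpM2r ?nu_ge0//.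
    by rewrite (le_trans (ler_norm C))// lerDr.
  have SKC z : nu (SV z) <= (K + `|C|) * nu z.
    by rewrite (le_trans (SVK z))// ler_wpM2r ?nu_ge0// lerDl.
  apply: (resolvent_of_direct_sum nuP TSV STV MVD MVZ NVD NVZ MNV PMV PNV SKC KC
    TMV (TNV TN) SNV l0).
    by apply: spectrum_inverse specT _; rewrite l1.
  by apply: spectrum_inverse specS _; rewrite normfV l1 invr1.
Qed.
End ConjugacyOfSpectra.

Lemma closed_subspaceP (R : realType) (k : base_field)
    (X : normedModType (scalars R k)) (M : set X) : closed_subspace M ->
  [/\ M 0, forall x y, M x -> M y -> M (x + y), forall a x, M x -> M (a *: x) & closed M].
Proof.
move=> [[M0 Ml] Mc]; rewrite inE in M0.
have MD a x y : M x -> M y -> M (a *: x + y).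
  by move=> Mx My; have := Ml a x y; rewrite !inE; apply.
split=> //; first by move=> x y Mx My; rewrite -[x]scale1r; exact: MD.
by move=> a x Mx; rewrite -[_ *: x]addr0; exact: MD.
Qed.

Lemma inverse_linear (K : pzRingType) (X : lmodType K) (T : {linear X -> X}) (S : X -> X) :
  cancel T S -> cancel S T -> linear S.
Proof. by move=> TS ST a x y; rewrite -{1}(ST x) -{1}(ST y) -linearP TS. Qed.

Section ComplexScalars.
Context {R : realType} {X : completeNormedModType R[i]}.
Local Notation Y := (realification X).

Lemma realification_compatible : @compatible_norm R X (fun x : X => `|x : Y|).
Proof.
split.
- by move=> x y; exact: (@ler_normD _ Y).
- by move=> x x0; apply/eqP; rewrite -[_ == _](@normr_eq0 _ Y) x0.
- by move=> t x; exact: (@normrZ _ Y t x).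
- move=> l x; rewrite -lecR rmorphM /= -!realification_normE normrZ.
  rewrite ler_wpM2r// normc_def lecR /taxicab.
  set a := complex.Re l; set b := complex.Im l.
  rewrite -(real_normK (num_real a)) -(real_normK (num_real b)).
  have := normr_ge0 a; have := normr_ge0 b; move: `|a| `|b| => u v v0 u0.
  rewrite -[leRHS]ger0_norm ?addr_ge0// -sqrtr_sqr ler_sqrt ?sqr_ge0//.
  by have := mulr_ge0 u0 v0; nra.
- move=> x U; split=> [/(@nbhs_ballP _ Y)[e /= e0 eU]|[e e0 eU]].
    exists e => // y yx; apply: eU; rewrite -(@ball_normE _ Y) /= distrC.
    exact: yx.
  apply/(@nbhs_ballP _ Y); exists e => //= y; rewrite -(@ball_normE _ Y) /= distrC.
  exact: eU.
Qed.

Lemma realification_linear (T : {linear X -> X}) : linear (T : Y -> Y).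
Proof. by move=> a x y; exact: (@linearP _ _ _ _ T a%:C%C). Qed.

Lemma complex_conjugacy (T : {linear X -> X}) :
  @generalized_hyperbolic R ComplexScalars X T ->
  @conjugacy_theorem R ComplexScalars X T (@hyperbolic R ComplexScalars X T).
Proof.
move=> [Tc [S [[_ _ TS' ST' Sc']]]].
have TS : cancel T S by move=> x; apply: TS'; rewrite inE.
have ST : cancel S T by move=> x; apply: ST'; rewrite inE.
have Sc : continuous S by move: Sc'; rewrite continuous_subspace_setT.
move=> [M [N [[/closed_subspaceP[M0 MD MZ Mc] /closed_subspaceP[N0 ND NZ Nc] MN]]]].
move=> [[TM sT] [SN sS]].
pose SV : {linear X -> X} := HB.pack S (GRing.isLinear.Build _ _ _ _ _ (inverse_linear TS ST)).
pose TY : {linear Y -> Y} := HB.pack (T : Y -> Y)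
  (GRing.isLinear.Build _ _ _ _ _ (realification_linear T)).
pose SY : {linear Y -> Y} := HB.pack (SV : Y -> Y)
  (GRing.isLinear.Build _ _ _ _ _ (realification_linear SV)).
have [KT KT0 TK] := @linear_bounded _ _ TY Tc.
have [KS KS0 SK] := @linear_bounded _ _ SY Sc.
have MN0 z : M z -> N z -> z = 0.
  by case: MN => MN0 _ Mz Nz; have : (M `&` N) z by []; rewrite MN0.
have TM' x : M x -> M (T x) by move=> Mx; apply: TM; exists x.
have SN' x : N x -> N (S x) by move=> Nx; apply: SN; exists x.
have MZR (t : R) (x : Y) : M x -> M (t *: x) by exact: MZ.
have NZR (t : R) (x : Y) : N x -> N (t *: x) by exact: NZ.
apply: (@conjugacy_of_spectra R Y TY SY M N TS ST Tc Sc Mc Nc (And3 M0 MD MZR)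
  (And3 N0 ND NZR) MN TM' SN' X (fun x : X => `|x : Y|) id id T SV M N (KT + KS)
  realification_compatible (addr_ge0 KT0 KS0) _ erefl _ _ _ _ _ _ TS ST _ _
  M0 MD MZ N0 ND NZ MN0 _ _ _ _ TM' SN' _ _ sT sS); try by [].
- by move=> z; apply: le_trans (TK z) _; rewrite ler_wpM2r// lerDl.
- by move=> z; apply: le_trans (SK z) _; rewrite ler_wpM2r// lerDr.
- move=> P PM PN /linear_bounded[C C0 PC]; exists P, C; split=> // x y.
  by have := PC (x - y); rewrite (linearB P).
Qed.

End ComplexScalars.

Section RealScalars.
Context {R : realType} {X : completeNormedModType R}.
Local Notation XC := (complexification X).

Lemma complexify_linear (A : {linear X -> X}) : linear (complexify A : XC -> XC).
Proof.
move=> l [x1 x2] [y1 y2]; rewrite /complexify /=.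
by congr pair; rewrite !(linearD A, linearN A, linearZ_LR A).
Qed.

Definition complexification_norm (z : XC) : R := `|z.1| + `|z.2|.

Lemma complexification_compatible : compatible_norm complexification_norm.
Proof.
split.
- move=> x y; rewrite /complexification_norm addrACA.
  by rewrite lerD// ler_normD.
- move=> [x y] /eqP; rewrite /complexification_norm paddr_eq0//= !normr_eq0.
  by move=> /andP[/eqP-> /eqP->].
- move=> t [x y]; rewrite /complexification_norm /= !scale0r subr0 addr0.
  by rewrite !normrZ mulrDr.
- move=> l [x y]; rewrite /complexification_norm /taxicab /=.
  have := ler_normB (complex.Re l *: x) (complex.Im l *: y).
  have := ler_normD (complex.Re l *: y) (complex.Im l *: x).
  by rewrite !normrZ; lra.
- move=> z U; split=> [/(@nbhs_ballP _ (X * X)%type)[e /= e0 eU]|[e e0 eU]].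
    exists e => // y yz; apply: eU.
    have := normr_ge0 (y.1 - z.1); have := normr_ge0 (y.2 - z.2).
    rewrite /complexification_norm /= in yz.
    by split; rewrite -ball_normE /= distrC; lra.
  (* The product carries the maximum norm, so each coordinate gets half of e. *)
  apply/(@nbhs_ballP _ (X * X)%type); exists (e / 2); first by rewrite /= divr_gt0.
  move=> y [y1 y2]; apply: eU; rewrite -!ball_normE /= in y1 y2.
  by rewrite /complexification_norm /= distrC (distrC y.2); lra.
Qed.

Lemma real_conjugacy (T : {linear X -> X}) :
  @generalized_hyperbolic R RealScalars X T ->
  @conjugacy_theorem R RealScalars X T (@hyperbolic R RealScalars X T).
Proof.
move=> [Tc [S [[_ _ TS' ST' Sc']]]].
have TS : cancel T S by move=> x; apply: TS'; rewrite inE.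
have ST : cancel S T by move=> x; apply: ST'; rewrite inE.
have Sc : continuous S by move: Sc'; rewrite continuous_subspace_setT.
move=> [M [N [[/closed_subspaceP[M0 MD MZ Mc] /closed_subspaceP[N0 ND NZ Nc] MN]]]].
move=> [[TM sT] [SN sS]].
pose SL : {linear X -> X} := HB.pack S (GRing.isLinear.Build _ _ _ _ _ (inverse_linear TS ST)).
pose TV : {linear XC -> XC} := HB.pack (complexify T : XC -> XC)
  (GRing.isLinear.Build _ _ _ _ _ (complexify_linear T)).
pose SV : {linear XC -> XC} := HB.pack (complexify SL : XC -> XC)
  (GRing.isLinear.Build _ _ _ _ _ (complexify_linear SL)).
have [KT KT0 TK] := linear_bounded Tc.
have [KS KS0 SK] := @linear_bounded _ _ SL Sc.
have MN0 z : M z -> N z -> z = 0.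
  by case: MN => MN0 _ Mz Nz; have : (M `&` N) z by []; rewrite MN0.
have TM' x : M x -> M (T x) by move=> Mx; apply: TM; exists x.
have SN' x : N x -> N (S x) by move=> Nx; apply: SN; exists x.
suff : @conjugacy_theorem R RealScalars X T
  (invertible_operator T /\ complex_spectrum [set: XC] TV `&` [set l | `|l| = 1] = set0).
  by rewrite /hyperbolic /= setXTT.
have prodD (U : set X) : (forall x y, U x -> U y -> U (x + y)) ->
    forall x y : XC, (U `*` U) x -> (U `*` U) y -> (U `*` U) (x + y).
  by move=> UD [x1 x2] [y1 y2] [/= x1U x2U] [/= y1U y2U]; split; apply: UD.
have prodZ (U : set X) : (forall x y, U x -> U y -> U (x + y)) ->
    (forall (a : R) x, U x -> U (a *: x)) ->
    forall (l : R[i]) (x : XC), (U `*` U) x -> (U `*` U) (l *: x).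
  move=> UD UZ l [x1 x2] [/= x1U x2U]; split => /=; apply: UD; try exact: UZ.
  by rewrite -scaleNr; exact: UZ.
have prod_le (A : {linear X -> X}) k : (forall x, `|A x| <= k * `|x|) -> k <= KT + KS ->
    forall z : XC, complexification_norm (complexify A z) <= (KT + KS) * complexification_norm z.
  move=> Ak kK [x y]; rewrite /complexification_norm /= mulrDr lerD//.
    by apply: le_trans (Ak x) _; rewrite ler_wpM2r.
  by apply: le_trans (Ak y) _; rewrite ler_wpM2r.
have emb_pair (U : set X) : U 0 -> forall x, U x -> (U `*` U) ((x, 0) : XC) by [].
have embA (A : {linear X -> X}) x : ((A x, 0) : XC) = complexify A (x, 0).
  by rewrite /complexify /= linear0.
have KTS : KT <= KT + KS by rewrite lerDl.
have KST : KS <= KT + KS by rewrite lerDr.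
apply: (@conjugacy_of_spectra R X T SL M N TS ST Tc Sc Mc Nc (And3 M0 MD MZ)
  (And3 N0 ND NZ) MN TM' SN' XC
  complexification_norm (fun x => (x, 0) : XC) fst TV SV (M `*` M) (N `*` N)
  (KT + KS) complexification_compatible (addr_ge0 KT0 KS0)).
- by [].
- by [].
- by move=> [x1 x2] [y1 y2].
- by move=> x; rewrite /complexification_norm /= normr0 addr0.
- exact: embA.
- exact: embA.
- by [].
- by [].
- by move=> [x y]; rewrite /= /complexify /= !TS.
- by move=> [x y]; rewrite /= /complexify /= !ST.
- exact: prod_le TK KTS.
- exact: (prod_le _ _ SK KST).
- by [].
- exact: prodD.
- exact: prodZ.
- by [].
- exact: prodD.
- exact: prodZ.
- by move=> [x y] [/= Mx My] [/= Nx Ny]; rewrite (MN0 x)// (MN0 y).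
- exact: emb_pair.
- by move=> z [].
- exact: emb_pair.
- by move=> z [].
- by move=> z [z1 z2]; split; apply: TM'.
- by move=> z [z1 z2]; split; apply: SN'.
- by move=> TN z [z1 z2]; split; apply: TN.
- move=> P PM PN /linear_bounded[C C0 PC].
  exists (complexify P), C; split; [by move=> z; split; exact: PM| |].
    by move=> z; split; exact: PN.
  move=> [x1 x2] [y1 y2]; rewrite /complexification_norm /= mulrDr -!(linearB P).
  by rewrite lerD.
- exact: sT.
- exact: sS.
Qed.
End RealScalars.


Local Close Scope ring_scope.
Local Open Scope ereal_scope.

Theorem theorem4 (R : realType) (k : base_field)
    (X : completeNormedModType (scalars R k)) (T : {linear X -> X}) :
  generalized_hyperbolic T ->
  (* (A) *)
  (exists eps : R, (0 < eps)%R /\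
    let admissible (p : nat) (L : 'I_p -> X -> X) :=
      forall j, sup_norm (L j) < +oo /\ Lip (L j) < eps%:E in
    let solution (p : nat) (L : 'I_p -> X -> X) (h : X -> X) :=
      conjugates h (perturbed_product T L) (iter p T) /\
      sup_norm (h \- idfun)%R < +oo in
    [/\ forall (p : nat) (L : 'I_p -> X -> X), (0 < p)%N ->
          admissible p L -> exists h, solution p L h,
        forall (p : nat) (L : 'I_p -> X -> X), (0 < p)%N ->
          admissible p L -> ((exists! h, solution p L h) <-> hyperbolic T)
      & forall p : nat, (0 < p)%N ->
          exists H : ('I_p -> X -> X) -> (X -> X),
            (forall L, admissible p L -> solution p L (H L)) /\
            (forall gamma : R, (0 < gamma)%R ->
              exists eta : R, (0 < eta)%R /\
                forall L L' : 'I_p -> X -> X,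
                  admissible p L -> admissible p L' ->
                  (forall j, sup_norm (L j \- L' j)%R < eta%:E) ->
                  sup_norm (H L \- H L')%R < gamma%:E)])
  /\
  (* (B) *)
  (forall delta : R, (0 < delta)%R -> exists eps : R, (0 < eps)%R /\
    let admissible (p : nat) (L : 'I_p -> X -> X) :=
      forall j, sup_norm (L j) < eps%:E /\ Lip (L j) < eps%:E in
    let solution (p : nat) (L : 'I_p -> X -> X) (h : X -> X) :=
      conjugates h (perturbed_product T L) (iter p T) /\
      sup_norm (h \- idfun)%R < delta%:E in
    [/\ forall (p : nat) (L : 'I_p -> X -> X), (0 < p)%N ->
          admissible p L -> exists h, solution p L h,
        forall (p : nat) (L : 'I_p -> X -> X), (0 < p)%N ->
          admissible p L -> ((exists! h, solution p L h) <-> hyperbolic T)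
      & forall p : nat, (0 < p)%N ->
          exists H : ('I_p -> X -> X) -> (X -> X),
            (forall L, admissible p L -> solution p L (H L)) /\
            (forall gamma : R, (0 < gamma)%R ->
              exists eta : R, (0 < eta)%R /\
                forall L L' : 'I_p -> X -> X,
                  admissible p L -> admissible p L' ->
                  (forall j, sup_norm (L j \- L' j)%R < eta%:E) ->
                  sup_norm (H L \- H L')%R < gamma%:E)]).
Proof.
by case: k X T => X T; [exact: real_conjugacy|exact: complex_conjugacy].
Qed.
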